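(* Let $r>0$ and let $f:C^0([-r,0];\mathbb{R}^n)\to\mathbb{R}^n$ satisfy $f(0)=0$ and be Lipschitz on bounded sets of $C^0([-r,0];\mathbb{R}^n)$. Let $p\in(1,+\infty]$ be given. Suppose that for every $x_0\in C^{0,1-1/p}([-r,0])$ the solution $x(t)\in\mathbb{R}^n$ of $\dot x(t)=f(x_t)$ with initial condition $x_0$ exists for all $t\ge0$. Then, both for $X=W^{1,p}([-r,0])$ and for $X=C^{0,1-1/p}([-r,0])$, the following property (RFC-X) holds: for every $\rho,T>0$, $$\sup\{\|\phi(t,x_0)\|_X:\ t\in[0,T],\ x_0\in X,\ \|x_0\|_X\le\rho\}<+\infty .$$
   Context: $|\cdot|$ is the Euclidean norm on $\mathbb{R}^n$ and $\mathbb{R}_+=[0,+\infty)$. $C^0([-r,0];\mathbb{R}^n)$ is the space of continuous functions with norm $\|x\|_\infty=\max_{s\in[-r,0]}|x(s)|$. $f$ is Lipschitz on bounded sets of $C^0([-r,0];\mathbb{R}^n)$ if there is a non-decreasing function $L:\mathbb{R}_+\to\mathbb{R}_+$ such that for every $R\ge 0$, $|f(x)-f(y)|\le L(R)\|x-y\|_\infty$ for all $x,y$ with $\|x\|_\infty\le R$, $\|y\|_\infty\le R$. For the system $\dot x(t)=f(x_t)$, $x(t)\in\mathbb{R}^n$ and $x_t\in C^0([-r,0];\mathbb{R}^n)$ is defined by $x_t(s)=x(t+s)$, $s\in[-r,0]$. For $x_0\in C^0([-r,0];\mathbb{R}^n)$, $\phi(t,x_0)$ denotes $x_t$, where $x(t)$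 is the (unique, maximally defined for $t\ge0$) solution with initial condition $x_0$. Function spaces ($1/p:=0$ when $p=+\infty$). $W^{1,p}([-r,0])$ is the space of absolutely continuous $x:[-r,0]\to\mathbb{R}^n$ with $\dot x\in L^p((-r,0);\mathbb{R}^n)$, with norm $\|x\|_X=\|x\|_\infty+\|\dot x\|_p$, where $\|\dot x\|_p=(\int_{-r}^0|\dot x(s)|^p ds)^{1/p}$ for $p<+\infty$ and the essential supremum of $|\dot x|$ for $p=+\infty$. For $a\in(0,1]$, $C^{0,a}([-r,0])$ is the space of $x\in C^0([-r,0];\mathbb{R}^n)$ with $\sup_{t,s\in[-r,0],t\ne s}|x(t)-x(s)|/|t-s|^a<+\infty$, with norm $\|x\|_X=\max\left(\|x\|_\infty,\sup_{t\ne s}|x(t)-x(s)|/|t-s|^a\right)$. If $x_0\in X$, with $X$ one of these spaces, then $\phi(t,x_0)\in X$ whenever it exists. *)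

(* Defs.v *)
From HB Require Import structures.
From mathcomp Require Import all_boot all_order all_algebra.
From mathcomp Require Import all_classical all_reals all_analysis.

Set Implicit Arguments.
Unset Strict Implicit.
Unset Printing Implicit Defensive.

Import Order.TTheory GRing.Theory Num.Theory.
Import numFieldNormedType.Exports.

Local Open Scope classical_set_scope.
Local Open Scope ring_scope.

(* The library's norm on 'rV[R]_n is the maximum norm (it induces the same
   topology as the Euclidean norm). *)
Definition enorm (R : realType) (n : nat) (v : 'rV[R]_n) : R :=
  Num.sqrt (\sum_(i < n) v ord0 i ^+ 2).

(* A function on [-r, 0] is represented by a total function on R of which only
   the restriction to [-r, 0] matters: every space, norm and equation below
   looks at arguments in [-r, 0] only. *)
Section spaces.
Context {R : realType} {n : nat}.
Implicit Types (r a : R) (p : \bar R) (x y : R -> 'rV[R]_n).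

Definition C0 r : set (R -> 'rV[R]_n) :=
  [set x | {within `[- r, 0], continuous x}].

Definition norm_C0 r x : \bar R :=
  ereal_sup [set (enorm (x s))%:E | s in `[- r, 0]].

Definition abs_continuous r x : Prop :=
  forall e : R, 0 < e -> exists2 d : R, 0 < d &
    forall (N : nat) (a b : 'I_N -> R),
      (forall i, - r <= a i /\ a i <= b i /\ b i <= 0) ->
      trivIset setT (fun i => `]a i, b i[%classic) ->
      \sum_(i < N) (b i - a i) < d ->
      \sum_(i < N) enorm (x (b i) - x (a i)) < e.

(* The L^p norm over (-r, 0) is taken on R after extending the integrand by 0.
   An absolutely continuous x is derivable almost everywhere on (-r, 0), so
   the value of [derive1 x] at the other points is immaterial. *)
Definition norm_Lp_deriv r p x : \bar R :=
  'N[@lebesgue_measure R]_p[(fun s : R => (enorm (derive1 x s))%:E) \_ `]- r, 0[].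

Definition W1p r p : set (R -> 'rV[R]_n) :=
  [set x | abs_continuous r x /\ (norm_Lp_deriv r p x < +oo)%E].

Definition norm_W1p r p x : \bar R := (norm_C0 r x + norm_Lp_deriv r p x)%E.

Definition holder_seminorm r a x : \bar R :=
  ereal_sup [set (enorm (x ts.1 - x ts.2) / (`|ts.1 - ts.2| `^ a))%:E
            | ts in [set ts : R * R | [/\ ts.1 \in `[- r, 0],
                                        ts.2 \in `[- r, 0] & ts.1 != ts.2]]].

Definition C0a r a : set (R -> 'rV[R]_n) :=
  [set x | C0 r x /\ (holder_seminorm r a x < +oo)%E].

Definition norm_C0a r a x : \bar R :=
  Order.max (norm_C0 r x) (holder_seminorm r a x).

End spaces.

(* The exponent 1 - 1/p; the library's inverse on \bar R satisfies +oo^-1 = 0. *)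
Definition holder_exponent (R : realType) (p : \bar R) : R := 1 - fine (p^-1)%E.

Section delay_system.
Context {R : realType} {n : nat}.
Implicit Types (r t : R) (b : \bar R) (x : R -> 'rV[R]_n)
  (f : (R -> 'rV[R]_n) -> 'rV[R]_n).

(* Taking x and y equal on [-r, 0] shows that f x is determined by the
   restriction of x to [-r, 0], so that f is a map from C^0([-r, 0]; R^n). Its
   values at functions that are not continuous on [-r, 0] are never used. *)
Definition lipschitz_on_bounded_sets r f : Prop :=
  exists L : R -> R,
    [/\ forall M : R, 0 <= M -> 0 <= L M,
        forall M1 M2 : R, 0 <= M1 -> M1 <= M2 -> L M1 <= L M2
      & forall (M : R) x y, 0 <= M -> C0 r x -> C0 r y ->
          (norm_C0 r x <= M%:E)%E -> (norm_C0 r y <= M%:E)%E ->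
          ((enorm (f x - f y))%:E <=
             (L M)%:E * norm_C0 r (x \- y)%R)%E].

Definition history x t : R -> 'rV[R]_n := fun s => x (t + s).

(* x is a solution on [-r, b); at t = 0 the derivative is the right one. *)
Definition is_solution f r x0 b x : Prop :=
  [/\ (0 < b)%E,
      {within [set t | - r <= t /\ (t%:E < b)%E], continuous x},
      {in `[- r, 0], x =1 x0},
      h^-1 *: (x h - x 0) @[h --> 0^'+] --> f (history x 0)
    & forall t, 0 < t -> (t%:E < b)%E -> is_derive t 1 x (f (history x t))].

Definition max_time f r x0 : \bar R :=
  ereal_sup [set b | exists x, is_solution f r x0 b x].

Definition max_solution f r x0 : R -> 'rV[R]_n :=
  xget (fun=> 0) [set x | is_solution f r x0 (max_time f r x0) x].

(* Meaningful for 0 <= t < max_time f r x0. *)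
Definition phi f r t x0 : R -> 'rV[R]_n := history (max_solution f r x0) t.

(* The first conjunct says that the supremum is taken over states phi(t, x0)
   that do exist and do belong to X. *)
Definition RFC f r (X : set (R -> 'rV[R]_n)) (normX : (R -> 'rV[R]_n) -> \bar R)
    : Prop :=
  forall rho T : R, 0 < rho -> 0 < T ->
    (forall t x0, t \in `[0, T] -> X x0 -> (normX x0 <= rho%:E)%E ->
       (t%:E < max_time f r x0)%E /\ X (phi f r t x0)) /\
    (ereal_sup ([set normX (phi f r t x0) | t in `[0, T]
                 & x0 in [set x0 | X x0 /\ (normX x0 <= rho%:E)%E]])%R < +oo)%E.

End delay_system.

(* Main.v *)
Require Import Defs.
From HB Require Import structures.
From mathcomp Require Import all_boot all_order all_algebra.
From mathcomp Require Import all_classical all_reals all_analysis.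
From mathcomp Require Import measurable_realfun ess_sup_inf ring lra.

Set Implicit Arguments.
Unset Strict Implicit.
Unset Printing Implicit Defensive.

Import Order.TTheory GRing.Theory Num.Theory.
Import numFieldNormedType.Exports.

Local Open Scope classical_set_scope.
Local Open Scope ring_scope.

(** Write [a] for the exponent 1 - 1/p, which is positive because p > 1.

    The heart of the matter is a bound on the states, uniform over all initial
    data in a ball of the Hoelder space C^{0,a} ([flow_bounded]). Such a ball is
    compact for uniform convergence ([holder_ball_cluster]). If solutions
    starting in it were not uniformly bounded on [0, T], data whose solutions
    exceed 1, 2, 3, ... would accumulate at some v in the same ball. By
    assumption the solution from v is global, hence bounded on [0, T]; and since
    f is Lipschitz on bounded sets, solutions whose data are uniformly close to
    v stay close to it on [0, T] ([solution_stable], a Gronwall argument). So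
    infinitely many of these solutions would share one bound: a contradiction.
    This is where completeness on the whole Hoelder space is used: even when the
    data lie in W^{1,p}, their limit v may only be Hoelder continuous.

    The rest transfers this bound to the norms of the two spaces. A bound on the
    states bounds the velocity f(x_t), hence makes the solution Lipschitz on
    [0, T]. The state x_t follows the initial state before time 0 and the
    Lipschitz part after it, so its Hoelder seminorm ([holder_history]) or the
    L^p norm of its derivative ([Lp_deriv_history]) is at most that of the
    initial state plus a constant.

    For W^{1,p} one has to know moreover that a ball of this space is bounded in
    C^{0,a} ([W1p_holder]). This follows from Hoelder's inequality, once the
    increments of an absolutely continuous function are the integrals of its
    almost everywhere derivative. The latter is proved here as follows: the
    total variation of an absolutely continuous F is absolutely continuous
    ([abs_cont_total_variation]), so F is a difference of monotone absolutely
    continuous functions; the Stieltjes measure of each of these vanishes on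
    Lebesgue null sets ([abs_cont_stieltjes_null]) and has a density by the
    Radon-Nikodym theorem ([abs_cont_density]); and the density is the
    derivative almost everywhere by Lebesgue's differentiation theorem
    ([abs_cont_derive_density]).

    Inside the proofs, vectors are measured by the maximum norm, for which
    estimates can be made coordinate by coordinate; it is equivalent to the
    Euclidean norm. *)

(** * Absolute continuity and total variation *)

Section absolute_continuity.
Context {R : realType}.
Implicit Types (a b c d : R) (F : R -> R) (p q : R * R) (ps qs : seq (R * R)).

Definition subinterval a b : pred (R * R) :=
  [pred p | [&& a <= p.1, p.1 <= p.2 & p.2 <= b]].

Definition nonoverlapping : rel (R * R) := [rel p q | (p.2 <= q.1) || (q.2 <= p.1)].

Definition total_length ps : R := \sum_(p <- ps) (p.2 - p.1).

Definition total_increment F ps : R := \sum_(p <- ps) `|F p.2 - F p.1|.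

(** Families of intervals are lists, so that they can be concatenated and their
    members replaced by partitions. *)
Definition abs_cont a b F : Prop := forall e, 0 < e -> exists2 d, 0 < d &
  forall ps, all (subinterval a b) ps -> pairwise nonoverlapping ps ->
    total_length ps < d -> total_increment F ps < e.

Lemma nonoverlapping_sub p q p' :
  subinterval p.1 p.2 p' -> nonoverlapping p q -> nonoverlapping p' q.
Proof.
move=> /and3P[h1 _ h2] /orP[h|h]; apply/orP.
  by left; exact: le_trans h.
by right; exact: le_trans h1.
Qed.

Fixpoint steps a (l : seq R) : seq (R * R) :=
  if l is x :: l' then (a, x) :: steps x l' else [::].

Lemma subinterval_trans a b c d p :
  a <= c -> d <= b -> subinterval c d p -> subinterval a b p.
Proof.
move=> ac db /and3P[h1 h2 h3]; apply/and3P; split => //; first exact: le_trans h1.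
exact: le_trans db.
Qed.

Lemma steps_subinterval a b l : itv_partition a b l -> all (subinterval a b) (steps a l).
Proof.
elim: l a => //= x l IH a [] /= /andP[ax xl] lb.
have xb : itv_partition x b l by split.
apply/andP; split; first by rewrite /subinterval/= lexx (ltW ax) (itv_partition_le xb).
apply: sub_all (IH _ xb) => p; apply: subinterval_trans => //; exact: ltW.
Qed.

Lemma steps_nonoverlapping a b l :
  itv_partition a b l -> pairwise nonoverlapping (steps a l).
Proof.
elim: l a => //= x l IH a [] /= /andP[ax xl] lb.
have xb : itv_partition x b l by split.
rewrite (IH _ xb) andbT.
apply: sub_all (steps_subinterval xb) => p /and3P[h _ _] /=.
by apply/orP; left.
Qed.

Lemma steps_length a b l : itv_partition a b l -> total_length (steps a l) = b - a.
Proof.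
elim: l a => [a|x l IH a].
  by move/itv_partition_nil ->; rewrite /total_length big_nil subrr.
move=> [] /= /andP[ax xl] lb; have xb : itv_partition x b l by split.
by rewrite /total_length big_cons; move: (IH _ xb); rewrite /total_length => ->/=; ring.
Qed.

Lemma steps_variation a b F l :
  itv_partition a b l -> total_increment F (steps a l) = variation a b F l.
Proof.
move=> lab; rewrite (variation_zip F lab) /total_increment.
elim: l a {lab} => [|x l IH] a; first by rewrite !big_nil.
by rewrite /= !big_cons/= IH.
Qed.

Lemma total_length_cat ps qs :
  total_length (ps ++ qs) = total_length ps + total_length qs.
Proof. by rewrite /total_length big_cat. Qed.

Lemma total_increment_cat F ps qs :
  total_increment F (ps ++ qs) = total_increment F ps + total_increment F qs.
Proof. by rewrite /total_increment big_cat. Qed.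

Lemma total_increment_ge0 F ps : 0 <= total_increment F ps.
Proof. by apply: sumr_ge0. Qed.

(** By induction on [ps]: replacing its first interval by an arbitrary partition
    moves it to [qs] without changing the total length, and the supremum over
    the partitions turns its increment into its total variation. *)
Lemma refine_to_variation a b F (d e : R) :
  (forall ps, all (subinterval a b) ps -> pairwise nonoverlapping ps ->
    total_length ps < d -> total_increment F ps < e) ->
  forall ps qs, all (subinterval a b) (ps ++ qs) ->
    pairwise nonoverlapping (ps ++ qs) -> total_length (ps ++ qs) < d ->
  (\sum_(p <- ps) total_variation p.1 p.2 F + (total_increment F qs)%:E <= e%:E)%E.
Proof.
move=> H; elim => [|p ps IH] qs.
  by move=> /= h1 h2 h3; rewrite big_nil add0e lee_fin ltW// H.
rewrite /= => /andP[pab hab] /andP[hp hpair] hlen.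
have p12 : p.1 <= p.2 by case/and3P: pab.
have len' : total_length (ps ++ qs) < d.
  apply: le_lt_trans hlen; rewrite /total_length big_cons lerDr subr_ge0.
  exact: p12.
have rest := IH qs hab hpair len'.
set rst := (X in (X <= _)%E) in rest.
have rest0 : (0 <= rst)%E.
  apply: adde_ge0; last by rewrite lee_fin total_increment_ge0.
  rewrite big_seq; apply: sume_ge0 => q qin; apply: total_variation_ge0.
  by move/allP : hab => /(_ q); rewrite mem_cat qin => /(_ isT) /and3P[].
have rfin : rst \is a fin_num by rewrite ge0_fin_numE// (le_lt_trans rest)// ltry.
rewrite big_cons -addeA -/rst -leeBrDr//.
apply: ge_ereal_sup => _ [_ [l lp <-] <-].
rewrite leeBrDr// /rst addeCA -EFinD -(steps_variation F lp) -total_increment_cat.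
apply: IH; rewrite ?total_length_cat ?(steps_length lp).
- rewrite !all_cat in hab *; case/andP: hab => -> ->; rewrite andbT /=.
  apply: sub_all (steps_subinterval lp) => q; apply: subinterval_trans.
    by case/and3P: pab.
  by case/and3P: pab.
- move: hp hpair; rewrite all_cat !pairwise_cat => /andP[hp1 hp2] /and3P[h1 h2 h3].
  rewrite h2 h3 (steps_nonoverlapping lp) /= andbT.
  have hs (us : seq (R * R)) : all (nonoverlapping p) us -> allrel nonoverlapping (steps p.1 l) us.
    move=> /allP hus; apply/allrelP => u v ul vus.
    move/allP: (steps_subinterval lp) => /(_ _ ul) hu.
    by apply: nonoverlapping_sub hu _; apply: hus.
  rewrite (hs _ hp2) andbT; apply/allrelP => u v uin vin.
  move: uin vin; rewrite mem_cat => uin /orP[vin|vin]; last first.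
    by move/allrelP: h1; apply.
  move: (hs _ hp1) => /allrelP /(_ _ _ vin uin).
  by move=> huv; rewrite /nonoverlapping/= orbC; exact: huv.
- by move: hlen; rewrite /total_length big_cons big_cat /=; lra.
Qed.

(** An interval shorter than the [d] given by epsilon = 1 has variation at most
    1, so the variation is finite by additivity. *)
Lemma abs_cont_total_variation_fin a b F x : abs_cont a b F -> a <= x -> x <= b ->
  total_variation a x F \is a fin_num.
Proof.
move=> FAC ax xb; rewrite ge0_fin_numE ?total_variation_ge0//.
have [d d0 /refine_to_variation H] := FAC 1 ltr01.
have small u v : a <= u -> u <= v -> v <= b -> v - u < d ->
    (total_variation u v F < +oo)%E.
  move=> au uv vb uvd.
  have := H [:: (u, v)] [::].
  rewrite /subinterval /= au uv vb big_cons big_nil /total_increment big_nil.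
  rewrite /total_length big_cons big_nil /= addr0 !adde0 => /(_ isT isT uvd) h.
  by rewrite (le_lt_trans h)// ltry.
have d20 : 0 < d / 2 by lra.
(* Steps of d / 2 keep the intervals strictly shorter than d. *)
have key k : forall y, a <= y -> y <= b -> y - a <= k%:R * (d / 2) ->
    (total_variation a y F < +oo)%E.
  elim: k => [|k IH] y ay yb.
    rewrite mul0r => ya; have -> : y = a by apply/eqP; rewrite eq_le ay andbT; lra.
    by rewrite total_variationxx ltry.
  rewrite -natr1 mulrDl mul1r => yk.
  have [yd|yd] := leP (y - a) (d / 2); first by apply: small => //; lra.
  rewrite (@total_variationD _ a y (y - d / 2)); [|lra..].
  apply: lte_add_pinfty; first by apply: IH; lra.
  by apply: small; lra.
apply: (key (Num.bound ((x - a) / (d / 2)))) => //.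
rewrite -ler_pdivrMr//; apply/ltW/archi_boundP.
by rewrite divr_ge0 ?subr_ge0// ltW.
Qed.

Lemma fine_total_variationB a b F x y : abs_cont a b F -> a <= x -> x <= y -> y <= b ->
  (fine (total_variation a y F) - fine (total_variation a x F))%:E =
  total_variation x y F.
Proof.
move=> FAC ax xy yb.
have fx := abs_cont_total_variation_fin FAC ax (le_trans xy yb).
have fy := abs_cont_total_variation_fin FAC (le_trans ax xy) yb.
by rewrite EFinB !fineK// (total_variationD F ax xy) addeAC subee ?add0e.
Qed.

Lemma abs_cont_total_variation a b F : abs_cont a b F ->
  abs_cont a b (fun x => fine (total_variation a x F)).
Proof.
move=> FAC e e0; have e20 : 0 < e / 2 by lra.
have [d d0 /refine_to_variation H] := FAC _ e20.
exists d => // ps psab psno psd; apply: (@le_lt_trans _ _ (e / 2)); last by lra.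
rewrite -lee_fin; have := H ps [::]; rewrite cats0 => /(_ psab psno psd).
rewrite {1}/total_increment big_nil adde0; apply: le_trans.
rewrite /total_increment -sumEFin !big_seq lee_sum// => p pps.
move/allP: psab => /(_ _ pps) /and3P[h1 h2 h3].
rewrite -(fine_total_variationB FAC h1 h2 h3) ger0_norm// -lee_fin.
by rewrite (fine_total_variationB FAC h1 h2 h3) total_variation_ge0.
Qed.

Lemma abs_contB a b F G : abs_cont a b F -> abs_cont a b G -> abs_cont a b (F \- G).
Proof.
move=> FAC GAC e e0; have e20 : 0 < e / 2 by lra.
have [d1 d10 H1] := FAC _ e20; have [d2 d20 H2] := GAC _ e20.
exists (Num.min d1 d2); first by rewrite lt_min d10.
move=> ps psab psno; rewrite lt_min => /andP[l1 l2].
have h1 := H1 ps psab psno l1; have h2 := H2 ps psab psno l2.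
apply: (@le_lt_trans _ _ (total_increment F ps + total_increment G ps)); last by lra.
rewrite /total_increment -big_split/=; apply: ler_sum => p _.
have -> : (F \- G) p.2 - (F \- G) p.1 = (F p.2 - F p.1) - (G p.2 - G p.1).
  by rewrite /=; ring.
exact: ler_normB.
Qed.

Lemma abs_cont_total_variation_nd a b F x y : abs_cont a b F -> a <= x -> x <= y -> y <= b ->
  fine (total_variation a x F) <= fine (total_variation a y F).
Proof.
move=> FAC ax xy yb; rewrite -subr_ge0 -lee_fin (fine_total_variationB FAC)//.
exact: total_variation_ge0.
Qed.

Lemma abs_cont_total_variationB_nd a b F x y : abs_cont a b F -> a <= x -> x <= y -> y <= b ->
  fine (total_variation a x F) - F x <= fine (total_variation a y F) - F y.
Proof.
move=> FAC ax xy yb; have := total_variation_ge F xy.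
rewrite -(fine_total_variationB FAC)// lee_fin => /(le_trans (ler_norm _)).
by lra.
Qed.

End absolute_continuity.

(** * Stieltjes measures of absolutely continuous functions *)

Section bisection.
Context {R : realType}.
Implicit Types (a b c d : R) (F : R -> R) (p q : R * R) (ps qs : seq (R * R)).
Implicit Types U : set R.
Local Notation mu := (@lebesgue_measure R).

(** The dyadic cells of ]c, d] that fit into [U] and are maximal among those
    obtained by at most [k] bisections. They exhaust an open [U] as [k] grows
    while being, at each level, a finite nonoverlapping family, to which
    absolute continuity applies. *)
Fixpoint bisect U (k : nat) c d : seq (R * R) :=
  if `[< `]c, d] `<=` U >] then [:: (c, d)] else
  if k is k'.+1 then
    bisect U k' c ((c + d) / 2) ++ bisect U k' ((c + d) / 2) d
  else [::].

Definition covered ps : set R := [set x | exists2 p, p \in ps & p.1 < x <= p.2].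

Lemma covered_cons p ps : covered (p :: ps) = `]p.1, p.2] `|` covered ps.
Proof.
apply/seteqP; split => x /=; rewrite in_itv/=.
  move=> [q]; rewrite inE => /predU1P[->|qps] xq; first by left.
  by right; exists q.
move=> [xp|[q qps xq]]; first by exists p => //; rewrite inE eqxx.
by exists q => //; rewrite inE qps orbT.
Qed.

Lemma covered_cat ps qs : covered (ps ++ qs) = covered ps `|` covered qs.
Proof.
apply/seteqP; split => x /=.
  by move=> [q]; rewrite mem_cat => /orP[] qps xq; [left|right]; exists q.
by move=> [[q qps xq]|[q qps xq]]; exists q => //; rewrite mem_cat qps ?orbT.
Qed.

Lemma measurable_covered ps : measurable (covered ps).
Proof.
elim: ps => [|p ps IH]; last by rewrite covered_cons; exact: measurableU.
by rewrite (_ : covered _ = set0)//; apply/seteqP; split => // x [].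
Qed.

Lemma bisect_subinterval U k c d : c <= d -> all (subinterval c d) (bisect U k c d).
Proof.
elim: k c d => [|k IH] c d cd /=; case: ifP => // _.
- by rewrite /subinterval/= !lexx cd.
- by rewrite /subinterval/= !lexx cd.
rewrite all_cat; apply/andP; split.
  by apply: sub_all (IH _ _ _); [move=> p; apply: subinterval_trans; lra|lra].
by apply: sub_all (IH _ _ _); [move=> p; apply: subinterval_trans; lra|lra].
Qed.

Lemma bisect_nonoverlapping U k c d :
  c <= d -> pairwise nonoverlapping (bisect U k c d).
Proof.
elim: k c d => [|k IH] c d cd /=; case: ifP => // _.
rewrite pairwise_cat !IH; [|lra..]; rewrite !andbT.
apply/allrelP => p q pin qin; apply/orP; left.
have cm : c <= (c + d) / 2 by lra.
have md : (c + d) / 2 <= d by lra.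
move/allP: (bisect_subinterval U k cm) => /(_ _ pin) /and3P[_ _ h1].
by move/allP: (bisect_subinterval U k md) => /(_ _ qin) /and3P[h2 _ _]; lra.
Qed.

Lemma covered_bisect_nd U k c d :
  covered (bisect U k c d) `<=` covered (bisect U k.+1 c d).
Proof.
elim: k c d => [|k IH] c d.
  by rewrite /=; case: ifP => _; [exact: subset_refl|by move=> x []].
move=> x; rewrite [bisect U k.+1 c d]/= [bisect U k.+2 c d]/=.
case: ifP => // _; rewrite !covered_cat.
by move=> [/IH|/IH] h; [left|right].
Qed.

(** After [k] bisections the cell that contains [x] is shorter than [e]. *)
Lemma covered_bisect U k c d x e : c < x <= d -> ball x e `<=` U ->
  d - c < e * 2 ^+ k -> covered (bisect U k c d) x.
Proof.
elim: k c d => [|k IH] c d /andP[cx xd] xeU.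
  rewrite expr0 mulr1 => cde /=; rewrite asboolT.
    by exists (c, d); rewrite ?inE//= cx.
  move=> y /=; rewrite in_itv/= => /andP[cy yd]; apply: xeU.
  by rewrite /ball/= ltr_norml; lra.
rewrite exprS => cde /=; case: ifP => _.
  by exists (c, d); rewrite ?inE//= cx.
rewrite covered_cat; have [xm|mx] := leP x ((c + d) / 2).
  by left; apply: IH => //; [rewrite cx|lra].
by right; apply: IH => //; [rewrite mx|lra].
Qed.

Lemma bisect_length U k c d : measurable U -> c <= d ->
  ((total_length (bisect U k c d))%:E <= mu (U `&` `]c, d]))%E.
Proof.
move=> mU.
have base c' d' : c' <= d' -> `]c', d'] `<=` U ->
    ((total_length [:: (c', d')])%:E <= mu (U `&` `]c', d']))%E.
  move=> cd /setIidr ->; rewrite /total_length big_cons big_nil addr0/=.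
  rewrite lebesgue_measure_itv/= lte_fin; case: ltP => //.
  by rewrite lee_fin subr_le0.
elim: k c d => [|k IH] c d cd /=; case: ifP => [/asboolP/base|_]; try exact.
  by rewrite /total_length big_nil.
rewrite total_length_cat EFinD.
have -> : U `&` `]c, d] = (U `&` `]c, (c + d) / 2]) `|` (U `&` `](c + d) / 2, d]).
  rewrite -setIUr -itv_bndbnd_setU// bnd_simp; lra.
rewrite measureU//; [|by apply: measurableI|by apply: measurableI|].
  by rewrite leeD// IH//; lra.
rewrite setIACA setIid; apply/seteqP; split => // x [_ []]/=.
by rewrite !in_itv/= => /andP[_ h1] /andP[h2 _]; lra.
Qed.

Lemma stieltjes_itv (G : cumulative R R) c d : c <= d ->
  lebesgue_stieltjes_measure G `]c, d] = (G d - G c)%:E.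
Proof.
move=> cd; rewrite /lebesgue_stieltjes_measure /measure_extension/=.
by rewrite measurable_mu_extE/= ?wlength_itv_bnd//; exact: is_ocitv.
Qed.

Lemma stieltjes_covered (G : cumulative R R) a b ps : all (subinterval a b) ps ->
  (lebesgue_stieltjes_measure G (covered ps) <= (total_increment G ps)%:E)%E.
Proof.
elim: ps => [|p ps IH] /=.
  move=> _; rewrite (_ : covered _ = set0) ?measure0 ?lee_fin ?total_increment_ge0//.
  by apply/seteqP; split => // x [].
move=> /andP[/and3P[_ pp _] /IH h].
rewrite covered_cons /total_increment big_cons EFinD.
apply: le_trans (measureU2 _ _ _) _ => //; first exact: measurable_covered.
apply: leeD => //; apply: (@le_trans _ _ (G p.2 - G p.1)%:E); last first.
  by rewrite lee_fin ler_norm.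
by rewrite -(stieltjes_itv G pp); exact: lexx.
Qed.

End bisection.

Section density.
Context {R : realType}.
Implicit Types (a b c d : R) (F G : R -> R).
Local Notation mu := (@lebesgue_measure R).

(** Precomposition with [clamp a b] extends a function on [a, b] by its end
    values; this makes a monotone function on [a, b] the cumulative function of
    a measure on the line. *)
Definition clamp a b (x : R) : R := Num.max a (Num.min x b).

Lemma clamp_itv a b x : a <= b -> a <= clamp a b x <= b.
Proof.
move=> ab; rewrite /clamp; apply/andP; split; first by rewrite le_max lexx.
by rewrite ge_max ab ge_min lexx orbT.
Qed.

Lemma clamp_id a b x : a <= x -> x <= b -> clamp a b x = x.
Proof. by move=> ax xb; rewrite /clamp min_l// max_r. Qed.

Lemma clamp_le a b x y : x <= y -> clamp a b x <= clamp a b y.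
Proof. by move=> xy; rewrite /clamp; apply: le_max2 => //; apply: le_min2. Qed.

Lemma clampB a b x y : x <= y -> clamp a b y - clamp a b x <= y - x.
Proof.
move=> xy; rewrite lerBlDr {1}/clamp ge_max; apply/andP; split.
  have : a <= clamp a b x by rewrite /clamp le_max lexx.
  by lra.
have [xb|bx] := leP x b.
  have : x <= clamp a b x by rewrite /clamp min_l// le_max lexx orbT.
  by rewrite ge_min; lra.
have : b <= clamp a b x by rewrite /clamp (min_r (ltW bx)) le_max lexx orbT.
by rewrite ge_min; lra.
Qed.

Lemma abs_cont_unif a b F : abs_cont a b F -> forall e, 0 < e -> exists2 d, 0 < d &
  forall x y, a <= x -> x <= y -> y <= b -> y - x < d -> `|F y - F x| < e.
Proof.
move=> FAC e /FAC[d d0 H]; exists d => // x y ax xy yb xyd.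
have := H [:: (x, y)]; rewrite /subinterval /= ax xy yb.
by rewrite /total_length /total_increment !big_cons !big_nil !addr0; exact.
Qed.

Lemma clamp_abs_cont_right_continuous a b F :
  a <= b -> abs_cont a b F -> right_continuous (F \o clamp a b).
Proof.
move=> ab FAC x; apply/(@cvgrPdist_lt _ R^o) => e e0.
have [d d0 H] := abs_cont_unif FAC e0.
near=> y; have xy : x <= y by near: y; exact: nbhs_right_ge.
rewrite distrC H//; [by case/andP: (clamp_itv x ab)|exact: clamp_le|by case/andP: (clamp_itv y ab)|].
rewrite (le_lt_trans (clampB _ _ xy))// ltrBlDl.
by near: y; apply: nbhs_right_lt; rewrite ltrDl.
Unshelve. all: by end_near. Qed.

(** A null set has an open neighbourhood [U] of arbitrarily small length. The
    dyadic cells of [U] at each level have even smaller total length, so absolute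
    continuity makes their mass small, and they exhaust [U]. *)
Lemma abs_cont_stieltjes_null a b F (G : cumulative R R) (A : set R) :
  a < b -> abs_cont a b F -> (forall x, a <= x -> x <= b -> G x = F x) ->
  measurable A -> mu A = 0 -> lebesgue_stieltjes_measure G (A `&` `]a, b]) = 0.
Proof.
move=> ab FAC GF mA A0; apply/eqP; rewrite eq_le measure_ge0 andbT.
apply/lee_addgt0Pr => e e0; rewrite add0e.
have [d d0 H] := FAC _ e0.
have [|U [oU AU UA]] := @lebesgue_regularity_outer R A d mA _ d0.
  by apply: (@le_lt_trans _ _ 0%E); [rewrite -A0; exact: lexx|exact: ltry].
have mU : measurable U by exact: open_measurable.
have Ud : (mu U < d%:E)%E.
  have -> : mu U = (mu A + mu (U `\` A))%E.
    rewrite -{1}(setDUK AU); apply: measureU => //; first exact: measurableD.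
    by apply/seteqP; split => // x [? []].
  by rewrite A0 add0e.
pose C k := covered (bisect U k a b).
have mC k : measurable (C k) by exact: measurable_covered.
have mbC : measurable (\bigcup_k C k) by exact: bigcup_measurable.
have AsubC : A `&` `]a, b] `<=` \bigcup_k C k.
  move=> x [Ax] /=; rewrite in_itv/= => xab.
  have /open_nbhs_nbhs := conj oU (AU _ Ax).
  move=> /nbhs_ballP[/= r r0 rU].
  have /cvgrPdist_lt /(_ 1 ltr01) : (fun k : nat => (b - a) / r * (2^-1) ^+ k) @ \oo --> (0 : R).
    rewrite -[X in _ --> X](mulr0 ((b - a) / r)); apply: cvgMr.
    by apply: cvg_expr; rewrite ger0_norm; lra.
  case => N _ /(_ N (leqnn N)); rewrite /= sub0r normrN => hN.
  exists N => //; apply: covered_bisect xab rU _.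
  have := le_lt_trans (ler_norm _) hN.
  by rewrite exprVn ltr_pdivrMr ?exprn_gt0// mul1r ltr_pdivrMr// mulrC.
apply: (@le_trans _ _ (lebesgue_stieltjes_measure G (\bigcup_k C k))).
  by apply: le_measure => //; rewrite inE//; exact: measurableI.
have ndC : nondecreasing_seq C.
  by apply/nondecreasing_seqP => k; apply/subsetPset; exact: covered_bisect_nd.
have cvC := nondecreasing_cvg_mu (mu := lebesgue_stieltjes_measure G) mC mbC ndC.
rewrite -(cvg_lim _ cvC)//; apply: lime_le; first exact: cvgP cvC.
near=> k; apply: (le_trans (stieltjes_covered _ (bisect_subinterval U k (ltW ab)))).
rewrite lee_fin ltW// (_ : total_increment G _ = total_increment F (bisect U k a b)).
    apply: H; [exact: bisect_subinterval (ltW ab)|exact: bisect_nonoverlapping (ltW ab)|].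
    rewrite -lte_fin; apply: le_lt_trans Ud.
    apply: le_trans (bisect_length k mU (ltW ab)) _.
    by apply: le_measure; rewrite ?inE//; apply: measurableI.
rewrite /total_increment !big_seq; apply: eq_bigr => p pin.
have /allP/(_ _ pin)/and3P[h1 h2 h3] := bisect_subinterval U k (ltW ab).
by rewrite !GF//; [exact: le_trans h3|exact: le_trans h2].
Unshelve. all: by end_near. Qed.

(** The density is the Radon-Nikodym derivative of the Stieltjes measure,
    restricted to ]a, b] to make it finite. *)
Lemma abs_cont_nd_density a b F : a < b -> abs_cont a b F ->
  (forall x y, a <= x -> x <= y -> y <= b -> F x <= F y) ->
  exists2 g : R -> R, mu.-integrable setT (EFin \o g) &
    forall x, a <= x -> x <= b ->
      (F x - F a)%:E = (\int[mu]_(t in `]a, x]) (g t)%:E)%E.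
Proof.
move=> ab FAC Fnd.
have Gnd : {homo F \o clamp a b : x y / x <= y}.
  move=> x y xy /=; apply: Fnd; [by case/andP: (clamp_itv x (ltW ab))|exact: clamp_le|].
  by case/andP: (clamp_itv y (ltW ab)).
have Grc := clamp_abs_cont_right_continuous (ltW ab) FAC.
pose G : cumulative R R := HB.pack (F \o clamp a b)
  (isCumulative.Build R _ R (F \o clamp a b) Gnd Grc).
have GF x : a <= x -> x <= b -> G x = F x by move=> ax xb; rewrite /G/= clamp_id.
have mI : measurable (`]a, b]%classic : set (measurableTypeR R)) by [].
have Ioo : (lebesgue_stieltjes_measure G `]a, b] < +oo)%E.
  by rewrite (stieltjes_itv G (ltW ab)) ltry.
pose nu : {finite_measure set (measurableTypeR R) -> \bar R} := mfrestr mI Ioo.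
have numu : nu `<< mu.
  apply/null_content_dominatesP => A mA A0; rewrite /nu /mfrestr /mrestr.
  exact: (abs_cont_stieltjes_null ab FAC GF mA A0).
have [g [g0 gfin gint gE]] := @radon_nikodym_sigma_finite _ _ R mu nu numu.
exists (fine \o g).
  by apply: eq_integrable gint => // x _ /=; rewrite fineK.
move=> x ax xb; under eq_integral do rewrite /= fineK//.
rewrite -gE//.
transitivity (lebesgue_stieltjes_measure G (`]a, x] `&` `]a, b])); last by [].
rewrite setIidl; last by apply: subset_itvl; rewrite bnd_simp.
by rewrite (stieltjes_itv G ax) !GF// ltW.
Qed.

(** Jordan's decomposition: with V the total variation, V and V - F are monotone
    and absolutely continuous. *)
Lemma abs_cont_density a b F : a < b -> abs_cont a b F ->
  exists2 g : R -> R, mu.-integrable setT (EFin \o g) &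
    forall x, a <= x -> x <= b ->
      (F x - F a)%:E = (\int[mu]_(t in `]a, x]) (g t)%:E)%E.
Proof.
move=> ab FAC; pose V x := fine (total_variation a x F).
have VAC : abs_cont a b V by exact: abs_cont_total_variation.
have [g gi gE] := abs_cont_nd_density ab VAC (fun x y => abs_cont_total_variation_nd FAC).
have [h hi hE] := abs_cont_nd_density ab (abs_contB VAC FAC)
  (fun x y => @abs_cont_total_variationB_nd _ _ _ _ x y FAC).
exists (g \- h); first by apply: eq_integrable (integrableB _ gi hi).
move=> x ax xb; have -> : F x - F a = (V x - V a) - ((V \- F) x - (V \- F) a).
  by rewrite /=; ring.
rewrite EFinB gE// hE//= -integralB//.
- by apply: integrableS gi.
- by apply: integrableS hi.
Qed.

(** At a Lebesgue point of [g], its indefinite integral has derivative [g]; and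
    almost every point is one. *)
Lemma abs_cont_derive_density a b F g : a < b -> mu.-integrable setT (EFin \o g) ->
  (forall x, a <= x -> x <= b ->
      (F x - F a)%:E = (\int[mu]_(t in `]a, x]) (g t)%:E)%E) ->
  {ae mu, forall x, a < x -> x < b -> is_derive x 1 F (g x)}.
Proof.
move=> ab gi gE.
have loc : locally_integrable setT g.
  rewrite (_ : g = g \_ setT); first exact: integrable_locally.
  by apply/funext => x; rewrite patchE in_setT.
have := @FTC1 _ g (BRight a) (fun y => integrableS measurableT _ _ gi) loc.
move=> /(_ (fun y => measurable_itv _) (fun y => @subsetT _ _)).
apply: filterS; first exact: (ae_filter_ringOfSetsType mu).
move=> x H ax xb.
have [D1 D2] := H ax.
have eqF : \forall z \near x, F a + \int[mu]_(t in `]a, z]) g t = F z.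
  near=> z; have az : a <= z by apply/ltW; near: z; exact: lt_nbhsr.
  have zb : z <= b by apply/ltW; near: z; exact: lt_nbhsl.
  by rewrite /Rintegral/= -gE//= addrC subrK.
apply: (near_eq_is_derive eqF); apply: DeriveDef.
  by apply: derivableD => //; exact: derivable_cst.
by rewrite deriveD//= derive_cst add0r -derive1E.
Unshelve. all: by end_near. Qed.

End density.

(** * Lower integrals and translations *)

Section lower_integral.
Local Open Scope ereal_scope.
Import HBNNSimple.
Context d (T : measurableType d) (R : realType).
Variable mu : {measure set T -> \bar R}.

Lemma ge0_le_poweR (p : R) (x y : \bar R) : (0 <= p)%R -> 0 <= x -> x <= y ->
  x `^ p <= y `^ p.
Proof.
move=> p0 x0 xy; apply: gt0_ler_poweR => //; rewrite in_itv/= leey andbT//.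
exact: le_trans xy.
Qed.

(** The integral of a nonnegative function that need not be measurable is a
    lower integral, which still does not see negligible sets: a simple function
    below [f] becomes one below [g] once it is cut off on a negligible set. *)
Lemma ae_le_lower_integral (f g : T -> \bar R) :
  (forall x, 0 <= f x) -> (forall x, 0 <= g x) ->
  {ae mu, forall x, f x <= g x} -> \int[mu]_x f x <= \int[mu]_x g x.
Proof.
move=> f0 g0 [N [mN N0 fgN]]; rewrite !ge0_integralTE//.
apply: ge_ereal_sup => _ [h /= hf <-].
have mNC : measurable (~` N) by exact: measurableC.
rewrite -integralT_nnsfun.
have -> : \int[mu]_x (h x)%:E = \int[mu]_x (proj_nnsfun h mNC x)%:E.
  apply: ge0_ae_eq_integral => //.
  - by apply/measurable_EFinP.
  - by apply/measurable_EFinP.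
  - by move=> x _; rewrite lee_fin.
  - by move=> x _; rewrite lee_fin.
  exists N; split => // x /= hx; apply: contrapT => Nx; apply: hx => _.
  by rewrite /= mindicE mem_set//= mulr1.
rewrite integralT_nnsfun; apply: ereal_sup_ubound; exists (proj_nnsfun h mNC) => //.
move=> x; rewrite /= mindicE; have [Nx|Nx] := pselect (N x).
  by rewrite memNset ?mulr0//= => /(_ Nx).
rewrite mem_set//= mulr1; apply: le_trans (hf x) _.
by apply: contrapT => fgx; apply: Nx; apply: fgN.
Qed.

Lemma ae_le_Lnorm (f g : T -> \bar R) (p : \bar R) : 0 < p ->
  (forall x, 0 <= f x) -> (forall x, 0 <= g x) ->
  {ae mu, forall x, f x <= g x} -> Lnorm mu p f <= Lnorm mu p g.
Proof.
move=> p0 f0 g0 fg; rewrite unlock /Lnorm; case: p p0 => [p| |] //= p0.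
  apply: ge0_le_poweR; first by rewrite invr_ge0 ltW.
    by apply: integral_ge0 => x _; exact: poweR_ge0.
  apply: ae_le_lower_integral => [x|x|]; [exact: poweR_ge0|exact: poweR_ge0|].
  apply: filterS fg => x fgx.
  by rewrite !gee0_abs//; apply: ge0_le_poweR => //; exact: ltW.
case: ifP => // _; apply: le_ess_sup; apply: filterS fg => x fgx /=.
by rewrite !gee0_abs.
Qed.

End lower_integral.

Section translation.
Context {R : realType}.
Local Notation mu := (@lebesgue_measure R).
Implicit Types t : R.

Lemma measurable_translation t : measurable_fun [set: measurableTypeR R]
  (fun s : measurableTypeR R => t + s : measurableTypeR R).
Proof. by apply: measurable_funD. Qed.

Lemma lebesgue_measure_translation t (A : set R) :
  measurable A -> mu ((fun s => t + s) @^-1` A) = mu A.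
Proof.
move=> mA; apply/esym.
pose tr : {mfun measurableTypeR R >-> measurableTypeR R} := HB.pack
  (fun s : measurableTypeR R => t + s : measurableTypeR R)
  (isMeasurableFun.Build _ _ _ _ _ (measurable_translation t)).
rewrite (@lebesgue_measure_unique R (pushforward mu tr))//.
move=> _ [[a b] _ <-]; rewrite /pushforward/=.
have -> : pushforward mu tr `]a, b]%classic = mu `]a - t, b - t]%classic.
  rewrite /pushforward/=; congr (mu _); apply/seteqP.
  by split => s /=; rewrite !in_itv/= => /andP[h1 h2]; lra.
rewrite !lebesgue_measure_itv/= !lte_fin.
rewrite (_ : (a - t < b - t) = (a < b)); last by rewrite ltrD2r.
by case: ifP => // _; rewrite -!EFinB; congr _%:E; ring.
Qed.

Lemma ae_translation t (P : R -> Prop) :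
  {ae mu, forall s, P s} -> {ae mu, forall s, P (t + s)}.
Proof.
move=> [N [mN N0 PN]]; exists ((fun s => t + s) @^-1` N); split.
- have := measurable_translation t measurableT mN; rewrite setTI; exact.
- by rewrite lebesgue_measure_translation.
- by move=> s /PN.
Qed.

Lemma ge0_integral_translation t (f : R -> \bar R) :
  measurable_fun setT f -> (forall s, 0 <= f s)%E ->
  (\int[mu]_s f (t + s)%R = \int[mu]_s f s)%E.
Proof.
move=> mf f0; have mt := measurable_translation t.
have := @ge0_integral_pushforward _ _ _ _ R _ mt mu setT f measurableT mf (fun s _ => f0 s).
rewrite preimage_setT => /= <-.
apply: eq_measure_integral => A mA _.
exact: lebesgue_measure_translation.
Qed.

Lemma Lnorm_translation t (f : R -> \bar R) (p : \bar R) : (0 < p)%E ->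
  measurable_fun setT f -> (Lnorm mu p (fun s => f (t + s)%R) <= Lnorm mu p f)%E.
Proof.
move=> p0 mf; rewrite unlock /Lnorm; case: p p0 => [p| |] //= p0.
  rewrite (@ge0_integral_translation t (fun s => (`|f s| `^ p)%E))//.
    apply: (measurableT_comp (measurable_poweR p)).
    exact: measurableT_comp.
  by move=> s; exact: poweR_ge0.
case: ifP => // _; apply/ess_supP.
by apply: (@ae_translation t (fun s => (`|f s| <= ess_sup mu (abse \o f))%E)); exact: ess_sup_ge.
Qed.

End translation.

(** * Curves: norms and speed *)

Section euclidean_norm.
Context {R : realType} {n : nat}.
Implicit Types v : 'rV[R]_n.

Lemma enorm_ge0 v : 0 <= enorm v.
Proof. exact: sqrtr_ge0. Qed.

Lemma entry_le_enorm v i : `|v ord0 i| <= enorm v.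
Proof.
rewrite -sqrtr_sqr ler_wsqrtr// (bigD1 i)//= lerDl.
by apply: sumr_ge0 => j _; exact: sqr_ge0.
Qed.

Lemma norm_le_enorm v : `|v| <= enorm v.
Proof.
rewrite /Num.Def.normr/= mx_normrE; apply: bigmax_le => [|[i j] _ /=]; first exact: enorm_ge0.
by rewrite ord1; exact: entry_le_enorm.
Qed.

Lemma entry_le_norm v i : `|v ord0 i| <= `|v|.
Proof.
rewrite [leRHS]/Num.Def.normr/= mx_normrE.
exact: (le_bigmax _ (fun ij => `|v ij.1 ij.2|) (ord0, i)).
Qed.

Lemma enorm_le_norm v : enorm v <= n.+1%:R * `|v|.
Proof.
rewrite -[leRHS]ger0_norm ?mulr_ge0// -sqrtr_sqr ler_wsqrtr//.
apply: (@le_trans _ _ (\sum_(i < n) `|v| ^+ 2)).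
  by apply: ler_sum => i _; rewrite -real_normK ?num_real// lerXn2r ?nnegrE// entry_le_norm.
rewrite sumr_const card_ord -[leLHS]mulr_natl exprMn; apply: ler_wpM2r; first exact: sqr_ge0.
rewrite -natrX ler_nat; case: n => // k.
by rewrite (@leq_trans k.+2)// leq_pmulr.
Qed.

End euclidean_norm.

Section speed.
Context {R : realType} {n : nat}.
Local Notation mu := (@lebesgue_measure R).
Implicit Types (r s t : R) (x : R -> 'rV[R]_n).

Lemma abs_continuous_entry r x i :
  abs_continuous r x -> abs_cont (- r) 0 (fun s => x s ord0 i).
Proof.
move=> xac e /xac[d d0 H]; exists d => // ps psr psno psd.
have mem_ps (j : 'I_(size ps)) : nth (0, 0) ps j \in ps by exact: mem_nth.
have := H (size ps) (fun j => (nth (0, 0) ps j).1) (fun j => (nth (0, 0) ps j).2).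
rewrite /total_length (big_nth (0, 0)) big_mkord in psd.
move=> /(_ _ _ psd) inc.
rewrite /total_increment (big_nth (0, 0)) big_mkord; apply: le_lt_trans (inc _ _).
- apply: ler_sum => j _; apply: le_trans (entry_le_enorm _ i).
  by rewrite !mxE.
- by move=> j; move/allP: psr => /(_ _ (mem_ps j)) /and3P[].
move=> j k _ _ [u /= []]; rewrite !in_itv/= => /andP[u1 u2] /andP[u3 u4].
have no (j' k' : 'I_(size ps)) : (j' < k')%N ->
    nonoverlapping (nth (0, 0) ps j') (nth (0, 0) ps k').
  move=> jk; move/(pairwiseP (0, 0)): psno; apply => //; rewrite inE; exact: ltn_ord.
apply/val_inj/eqP; rewrite eqn_leq; apply/andP; split; rewrite leqNgt; apply/negP.
  by move=> /no /orP[]; lra.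
by move=> /no /orP[]; lra.
Qed.

(** [m] is the Euclidean norm of the densities of the coordinates. Being
    measurable, it can be used in Hoelder's and Minkowski's inequalities in
    place of the norm of [derive1 x], whose values on the null set where [x] is
    not derivable are arbitrary. *)
Lemma abs_continuous_speed r x : 0 < r -> abs_continuous r x ->
  exists m : R -> R, [/\ measurable_fun setT m, forall s, 0 <= m s,
    {ae mu, forall s, ((fun s => (enorm (derive1 x s))%:E) \_ `]- r, 0[) s = (m s)%:E} &
    forall s t i, - r <= s -> s <= t -> t <= 0 ->
     (`|x t ord0 i - x s ord0 i|%:E <= \int[mu]_(u in `]s, t]) (m u)%:E)%E].
Proof.
move=> r0 xac; have nr0 : - r < 0 by rewrite oppr_lt0.
have /choice[g gP] : forall i, exists g : R -> R, mu.-integrable setT (EFin \o g) /\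
    forall s, - r <= s -> s <= 0 ->
      (x s ord0 i - x (- r) ord0 i)%:E = (\int[mu]_(t in `](- r)%R, s]) (g t)%:E)%E.
  move=> i; have [g g1 g2] := abs_cont_density nr0 (abs_continuous_entry i xac).
  by exists g.
have mg i : measurable_fun setT (g i).
  by apply/measurable_EFinP; case/integrableP : (gP i).1.
pose m0 s := Num.sqrt (\sum_(i < n) g i s ^+ 2).
have mm0 : measurable_fun setT m0.
  apply: (@measurableT_comp _ _ _ _ _ _ (@Num.sqrt R)).
    by apply: continuous_measurable_fun; exact: sqrt_continuous.
  by apply: measurable_sum => i; apply: measurable_funX.
have gm0 i s : `|g i s| <= m0 s.
  by have := entry_le_enorm (\row_j g j s) i; rewrite /enorm mxE; under eq_bigr do rewrite mxE.
(* The endpoint 0 is kept, because the increments are integrals over ]s, t]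
   with t = 0 allowed. *)
exists (m0 \_ `]- r, 0]); split.
- by apply/(measurable_restrictT _ _).1 => //; exact: measurable_funS mm0.
- by move=> s; rewrite patchE; case: ifP => // _; exact: sqrtr_ge0.
- have ae0 : {ae mu, forall s : R, s != 0}.
    exists [set 0]; split => //; first exact: lebesgue_measure_set1.
    by move=> s /= /negP; rewrite negbK => /eqP.
  have aeg : {ae mu, forall s, forall i, - r < s -> s < 0 ->
      is_derive s 1 (fun t => x t ord0 i) (g i s)}.
    apply: filter_forall => i; exact: (abs_cont_derive_density nr0 (gP i).1 (gP i).2).
  have FF := ae_filter_ringOfSetsType mu.
  apply: (filterS2 _ _ ae0 aeg) => s s0 H; rewrite !patchE.
  have -> : (s \in `]- r, 0]%classic) = (s \in `]- r, 0[%classic).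
    by rewrite !mem_setE !in_itv/= le_eqVlt (negbTE s0).
  case: ifPn => //; rewrite mem_setE in_itv/= => /andP[rs s_lt0].
  have xs : derivable x s 1 by apply/derivable_mxP => i j; rewrite ord1; case: (H j rs s_lt0).
  rewrite derive1E derive_mx// /m0 /enorm; congr (Num.sqrt _)%:E.
  apply: eq_bigr => i _; rewrite mxE; congr (_ ^+ 2).
  by have := H i rs s_lt0; move=> ?; rewrite derive_val.
- move=> s t i rs st t0; have [g1 g2] := gP i.
  have gst : (x t ord0 i - x s ord0 i)%:E = (\int[mu]_(u in `]s, t]) (g i u)%:E)%E.
    have gi A : measurable A -> mu.-integrable A (EFin \o g i).
      by move=> mA; exact: integrableS g1.
    have := @Rintegral_itvB R (g i) (BRight (- r)) (BRight t) s (gi _ (measurable_itv _)).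
    rewrite !bnd_simp => /(_ rs st); rewrite /Rintegral -!g2//; last 2 first.
    - exact: le_trans t0.
    - exact: le_trans st.
    rewrite /= => gst; rewrite -[RHS]fineK; last exact: integrable_fin_num (gi _ _).
    by rewrite -gst; congr _%:E; ring.
  rewrite -abse_EFin gst; apply: le_trans (le_abse_integral _ _ _) _ => //.
    by apply/measurable_EFinP; exact: measurable_funS (mg i).
  apply: ge0_le_integral => //.
  + by apply/measurable_EFinP; apply: measurableT_comp => //; exact: measurable_funS (mg i).
  + apply/measurable_EFinP; apply: (@measurable_funS _ _ _ _ setT) => //.
    by apply/(measurable_restrictT _ _).1 => //; exact: measurable_funS mm0.
  move=> u /=; rewrite in_itv/= => /andP[su ut]; rewrite lee_fin patchE ifT//.
  by rewrite mem_setE in_itv/=; apply/andP; split; lra.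
Qed.

End speed.

(** * Sobolev and Hoelder estimates *)

Section sobolev_holder.
Context {R : realType} {n : nat}.
Local Notation mu := (@lebesgue_measure R).
Implicit Types (r s t : R) (x : R -> 'rV[R]_n) (p : \bar R).

Lemma lebesgue_measureT_gt0 : (0 < mu [set: R])%E.
Proof.
by rewrite -set_itvNyy lebesgue_measure_itv/= addye// ltry.
Qed.

Lemma holder_exponent_EFin (p : R) : 0 < p -> holder_exponent p%:E = 1 - p^-1.
Proof. by move=> p0; rewrite /holder_exponent inver gt_eqF. Qed.

Lemma holder_exponent_itv p : (1 < p)%E -> 0 < holder_exponent p <= 1.
Proof.
case: p => [p| |]//.
  rewrite lte_fin => p1; have p0 : 0 < p by exact: lt_trans p1.
  rewrite holder_exponent_EFin// subr_gt0 invf_lt1// p1/= gerBl invr_ge0.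
  exact: ltW.
by rewrite /holder_exponent invey/= subr0 ltr01 lexx.
Qed.

(** Hoelder's inequality against the indicator function of ]s, t], whose norm for
    the conjugate exponent is (t - s)^(1 - 1/p); for p infinite, the essential
    supremum bounds the integrand. *)
Lemma integral_itv_holder (m : R -> R) (M s t : R) p : (1 < p)%E ->
  measurable_fun setT m -> (forall u, 0 <= m u) ->
  (Lnorm mu p (EFin \o m) <= M%:E)%E -> s <= t ->
  (\int[mu]_(u in `]s, t]) (m u)%:E <= (M * (t - s) `^ holder_exponent p)%:E)%E.
Proof.
move=> p1 mm m0 mM st.
have muI : mu (`]s, t]%classic : set R) = (t - s)%:E.
  rewrite lebesgue_measure_itv/= lte_fin; case: ltP => [_|ts]; first by rewrite EFinB.
  by congr _%:E; apply/eqP; rewrite eq_sym subr_eq0 eq_le ts st.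
case: p p1 mM => [p| |]// => [|_ mM].
  rewrite lte_fin => p1 mM; have p0 : 0 < p by exact: lt_trans p1.
  have /andP[he0 _] := holder_exponent_itv (p1 : (1 < p%:E)%E).
  rewrite holder_exponent_EFin// in he0 *; set a := 1 - p^-1 in he0 *.
  have := @hoelder _ _ R mu m (\1_`]s, t]) p a^-1 mm (measurable_indic _) p0.
  rewrite invr_gt0 he0 invrK => /(_ _ isT) H.
  have {}H := H (measurable_itv _).
  have {}H : (p^-1 + a = 1)%R -> _ := H.
  have {}H := H (subrKC _ _).
  have <- : Lnorm mu 1%E (EFin \o (m \* \1_`]s, t])%R) = (\int[mu]_(u in `]s, t]) (m u)%:E)%E.
    rewrite Lnorm1 [RHS]integral_mkcond; apply: eq_integral => u _.
    rewrite patchE /= indicE; case: ifP => _; first by rewrite mulr1 ger0_norm.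
    by rewrite mulr0 normr0.
  apply: le_trans H _; rewrite EFinM; apply: lee_pmul => //; [exact: Lnorm_ge0..|].
  rewrite unlock /Lnorm invrK.
  rewrite (_ : (fun u => _) = (fun u => (\1_`]s, t] u)%:E)); last first.
    apply/funext => u; rewrite /= indicE; case: (u \in _); first by rewrite normr1 powR1.
    by rewrite normr0 powR0// invr_neq0// gt_eqF.
  rewrite [X in (X `^ _ <= _)%E](_ : _ = (t - s)%:E)%E ?poweR_EFin//.
  by rewrite integral_indic// setIT; exact: muI.
have M0 : (0 <= M%:E)%E := le_trans (Lnorm_ge0 _ _ _) mM.
move: mM; rewrite unlock /Lnorm lebesgue_measureT_gt0 => /ess_supP mM.
rewrite /holder_exponent invey/= subr0 powRr1 ?subr_ge0//.
apply: (@le_trans _ _ (\int[mu]_(u in `]s, t]) (M%:E)))%E.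
  apply: ae_ge0_le_integral => //.
  - by move=> u _; rewrite lee_fin.
  - by apply/measurable_EFinP; exact: measurable_funS mm.
  apply: filterS mM => u /= + _; rewrite ger0_norm//.
by rewrite integral_cst// EFinM -muI; exact: lexx.
Qed.

Lemma speed_ge0 r x s : (0 <= ((fun s => (enorm (derive1 x s))%:E) \_ `](- r)%R, 0%R[) s)%E.
Proof. by rewrite patchE; case: ifP => // _; rewrite lee_fin enorm_ge0. Qed.

(** Morrey's embedding in dimension one: an increment is at most the integral of
    the speed, to which Hoelder's inequality applies. *)
Lemma W1p_holder r p x (M : R) s t : 0 < r -> (1 < p)%E -> abs_continuous r x ->
  (norm_Lp_deriv r p x <= M%:E)%E -> - r <= s -> s <= t -> t <= 0 ->
  `|x t - x s| <= M * (t - s) `^ holder_exponent p.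
Proof.
move=> r0 p1 xac xM rs st t0.
have [m [mm m0 mx inc]] := abs_continuous_speed r0 xac.
have mM : (Lnorm mu p (EFin \o m) <= M%:E)%E.
  apply: le_trans xM; apply: ae_le_Lnorm; first exact: lt_trans p1.
  - by move=> u; rewrite lee_fin.
  - by move=> u; exact: speed_ge0.
  by have FF := ae_filter_ringOfSetsType mu; apply: (filterS _ mx) => u ->.
have H := integral_itv_holder p1 mm m0 mM st.
rewrite /Num.Def.normr/= mx_normrE; apply: bigmax_le => [|[j i] _ /=].
  by rewrite -lee_fin (le_trans _ H)// integral_ge0// => u _; rewrite lee_fin.
rewrite ord1 !mxE -lee_fin; apply: le_trans H; exact: inc.
Qed.

Lemma derive1_history x t s : derive1 (history x t) s = derive1 x (t + s).
Proof.
rewrite /derive1; suff -> : (fun h => h^-1 *: (history x t (h + s) - history x t s)) =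
  (fun h => h^-1 *: (x (h + (t + s)) - x (t + s))) by [].
by apply/funext => h; rewrite /history addrCA.
Qed.

Lemma derive1_near x y s : (\near s, x s = y s) -> derive1 x s = derive1 y s.
Proof. by move=> xy; rewrite !derive1E; exact: near_eq_derive. Qed.

(** Before time 0 the speed of the history is the translated speed of [x0], after
    it is at most [C]; Minkowski's inequality adds the two contributions. *)
Lemma Lp_deriv_history r p x0 x (t C : R) : 0 < r -> (1 < p)%E -> 0 <= t ->
  0 <= C -> abs_continuous r x0 -> {in `[- r, 0], x =1 x0} ->
  (forall s, 0 < s -> s < t -> enorm (derive1 x s) <= C) ->
  (norm_Lp_deriv r p (history x t) <=
    norm_Lp_deriv r p x0 + Lnorm mu p (EFin \o (C \o* \1_`](- r)%R, 0%R[)))%E.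
Proof.
move=> r0 p1 t0 C0 xac xx0 xC.
have [m [mm m0 mx _]] := abs_continuous_speed r0 xac.
have p0 : (0 < p)%E by exact: lt_trans p1.
have FF := ae_filter_ringOfSetsType mu.
have mmt : measurable_fun setT (fun s => m (t + s)).
  exact: (measurableT_comp mm (measurable_translation t)).
have aet : {ae mu, forall s : R, t + s != 0}.
  apply: (@ae_translation _ t (fun s => s != 0)).
  exists [set 0]; split => //; first exact: lebesgue_measure_set1.
  by move=> s /= /negP; rewrite negbK => /eqP.
apply: (@le_trans _ _ (Lnorm mu p (EFin \o ((fun s => m (t + s)) \+ (C \o* \1_`](- r)%R, 0%R[))%R))).
  apply: ae_le_Lnorm => //.
  - by move=> s; exact: speed_ge0.
  - by move=> s; rewrite lee_fin addr_ge0// mulr_ge0.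
  apply: (filterS2 _ _ aet (ae_translation t mx)) => s ts0 mts.
  rewrite patchE; case: ifPn => [sI|_]; last by rewrite lee_fin addr_ge0// mulr_ge0.
  rewrite /= indicE sI mul1r lee_fin derive1_history.
  move: sI; rewrite mem_setE in_itv/= => /andP[rs s0].
  have := ts0; rewrite neq_lt => /orP[ts|ts].
    have e : derive1 x (t + s) = derive1 x0 (t + s).
      apply: derive1_near; near=> u; apply: xx0.
      rewrite in_itv/=; apply/andP; split; apply/ltW; near: u.
        by apply: lt_nbhsr; lra.
      exact: lt_nbhsl.
    move: mts; rewrite patchE mem_setE in_itv/= ts andbT ifT; last by lra.
    by move=> [<-]; rewrite e lerDl.
  by apply: (le_trans (xC _ ts _)); [lra|rewrite lerDr].
apply: le_trans (eminkowski _ _ _ _) _ => //; last 1 first.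
- apply: leeD => //; apply: (@le_trans _ _ (Lnorm mu p (EFin \o m))).
    apply: (Lnorm_translation t p0); exact/measurable_EFinP.
  apply: ae_le_Lnorm => //; first by move=> s; exact: speed_ge0.
  by apply: (filterS _ mx) => s ->.
- by apply: measurable_funM => //; exact: measurable_indic.
- exact: ltW.
Unshelve. all: by end_near. Qed.

Lemma Lnorm_cst_itv_lty (C r : R) p : (1 < p)%E ->
  (Lnorm mu p (EFin \o (C \o* \1_`](- r)%R, 0%R[)) < +oo)%E.
Proof.
case: p => [p| |]// p1; rewrite unlock /Lnorm.
  have p0 : 0 < p by move: p1; rewrite lte_fin; exact: lt_trans.
  apply: poweR_lty.
  rewrite (_ : (fun u => _) = (fun u => (`|C| `^ p)%:E * (\1_`](- r)%R, 0%R[ u)%:E)%E); last first.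
    apply/funext => u; rewrite /= indicE -EFinM; case: (u \in _).
      by rewrite mul1r mulr1.
    by rewrite mul0r mulr0 normr0 powR0// gt_eqF.
  rewrite ge0_integralZl//; last by apply/measurable_EFinP; exact: measurable_indic.
  rewrite integral_indic// setIT lte_mul_pinfty//.
  apply: (@le_lt_trans _ _ (mu `](- r)%R, 0%R[%classic)); first exact: lexx.
  by rewrite lebesgue_measure_itv/=; case: ifP => _; rewrite ?ltry.
rewrite lebesgue_measureT_gt0.
apply: (@le_lt_trans _ _ (`|C|%:E)%E); last by rewrite ltry.
apply/ess_supP; apply: nearW => u /=; rewrite lee_fin indicE.
by case: (u \in _); rewrite ?mul1r ?mul0r ?normr0.
Qed.

(** The image of [s] under the shift by [t], cut off at time 0. An increment of
    the history of [x] at [t] is the sum of an increment of the initial state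
    between two such times and of an increment of [x] at nonnegative times. *)
Definition past t s : R := Num.min (t + s) 0.

Lemma past_itv r t s : 0 <= r -> 0 <= t -> - r <= s -> - r <= past t s <= 0.
Proof.
move=> r0 t0 rs; rewrite /past le_min ge_min lexx orbT andbT.
by apply/andP; split; lra.
Qed.

Lemma past_le t s s' : s <= s' -> past t s <= past t s'.
Proof. by move=> ss'; apply: le_min2 => //; rewrite lerD2l. Qed.

Lemma pastB_le t s s' : s <= s' -> past t s' - past t s <= s' - s.
Proof.
move=> ss'; have addmm u : past t u + Num.max (t + u) 0 = t + u.
  by rewrite /past addr_min_max addr0.
have : Num.max (t + s) 0 <= Num.max (t + s') 0 by apply: le_max2 => //; rewrite lerD2l.
by have := addmm s; have := addmm s'; lra.
Qed.

Lemma history_increment r x0 x t K u v : 0 <= r -> 0 <= t -> 0 <= K ->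
  {in `[- r, 0], x =1 x0} ->
  (forall u v, 0 <= u -> u <= v -> v <= t -> `|x v - x u| <= K * (v - u)) ->
  - r <= u -> u <= v -> v <= 0 ->
  `|history x t v - history x t u| <= `|x0 (past t v) - x0 (past t u)| + K * (v - u).
Proof.
move=> r0 t0 K0 xx0 xK ru uv v0; pose hi (s : R) := Num.max (t + s) 0.
have split_x s : x (t + s) = x (past t s) + (x (hi s) - x 0).
  rewrite /past /hi; case: (leP (t + s) 0) => h; first by rewrite subrr addr0.
  by rewrite [RHS]addrC subrK.
rewrite /history (split_x v) (split_x u) opprD addrACA.
apply: le_trans (ler_normD _ _) _; apply: lerD.
  by rewrite !xx0// in_itv/=; apply: past_itv => //; exact: le_trans uv.
rewrite opprB addrA subrK.
have hi_le : hi u <= hi v by apply: le_max2 => //; rewrite lerD2l.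
apply: (@le_trans _ _ (K * (hi v - hi u))).
  apply: xK => //; first by rewrite /hi le_max lexx orbT.
  by rewrite /hi ge_max t0 andbT gerDl.
apply: ler_wpM2l => //; have := past_le t uv.
have addmm s : past t s + hi s = t + s by rewrite /past addr_min_max addr0.
by have := addmm u; have := addmm v; lra.
Qed.

Lemma abs_continuous_history r x0 x (t K : R) : 0 <= r -> 0 <= t -> 0 <= K ->
  abs_continuous r x0 -> {in `[- r, 0], x =1 x0} ->
  (forall u v, 0 <= u -> u <= v -> v <= t -> `|x v - x u| <= K * (v - u)) ->
  abs_continuous r (history x t).
Proof.
move=> r0 t0 K0 xac xx0 xK e e0.
pose c : R := n.+1%:R; have c0 : 0 < c by rewrite ltr0n.
have e1 : 0 < e / (2 * c) by rewrite divr_gt0// mulr_gt0.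
have [d1 d10 H] := xac _ e1.
have K1 : 0 < K + 1 by lra.
exists (Num.min d1 (e / (2 * c) / (K + 1))); first by rewrite lt_min d10 divr_gt0.
move=> N a b ab tab; rewrite lt_min => /andP[sd1 sd2].
have bnd i : enorm (history x t (b i) - history x t (a i)) <=
    c * (enorm (x0 (past t (b i)) - x0 (past t (a i))) + K * (b i - a i)).
  have [ra [ai bi]] := ab i.
  apply: le_trans (enorm_le_norm _) _; rewrite ler_pM2l//.
  apply: le_trans (history_increment r0 t0 K0 xx0 xK ra ai bi) _.
  by rewrite lerD2r norm_le_enorm.
apply: (@le_lt_trans _ _ (\sum_(i < N)
    c * (enorm (x0 (past t (b i)) - x0 (past t (a i))) + K * (b i - a i)))).
  exact: ler_sum.
rewrite -mulr_sumr big_split/= -mulr_sumr.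
have s1 : \sum_(i < N) enorm (x0 (past t (b i)) - x0 (past t (a i))) < e / (2 * c).
  apply: (H N (past t \o a) (past t \o b)).
  - move=> i; have [ra [ai bi]] := ab i.
    have /andP[h1 _] := past_itv r0 t0 ra.
    have /andP[_ h2] := past_itv r0 t0 (le_trans ra ai).
    by split => //; split => //; exact: past_le.
  - move=> i j _ _ [u /= []]; rewrite !in_itv/= /past !lt_min !gt_min => h1 h2.
    apply: tab => //; exists (u - t); split => /=; rewrite in_itv/=.
      by case/andP: h1 => /orP[]; lra.
    by case/andP: h2 => /orP[]; lra.
  - apply: le_lt_trans sd1; apply: ler_sum => i _ /=; have [_ [ai _]] := ab i.
    exact: pastB_le.
have s2 : K * (\sum_(i < N) (b i - a i)) < e / (2 * c).
  move: sd2; rewrite ltr_pdivlMr// => sd2; apply: le_lt_trans sd2.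
  rewrite mulrC; apply: ler_wpM2l; last by lra.
  by apply: sumr_ge0 => i _; have [_ [ai _]] := ab i; rewrite subr_ge0.
(* Each of the two parts was made smaller than e / (2 c), to allow for the
   comparison constant c of the norms. *)
have -> : e = c * (e / (2 * c) + e / (2 * c)).
  by field; rewrite gt_eqF.
by rewrite ltr_pM2l// ltrD.
Qed.

End sobolev_holder.

(** * States and the vector field in the maximum norm *)

Section state_space.
Context {R : realType} {n : nat}.
Implicit Types (r a M D H : R) (x y : R -> 'rV[R]_n)
  (f : (R -> 'rV[R]_n) -> 'rV[R]_n).

(** The comparison constant of [enorm_le_norm], positive also in dimension 0. *)
Local Notation c := (n.+1%:R : R).

Lemma norm_C0_leP r x (M : R) : (norm_C0 r x <= M%:E)%E <->
  (forall s, s \in `[- r, 0] -> enorm (x s) <= M).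
Proof.
split=> [xM s sI|xM].
  by rewrite -lee_fin; apply: le_trans xM; apply: ereal_sup_ubound; exists s.
by apply: ge_ereal_sup => _ [s sI <-]; rewrite lee_fin; exact: xM.
Qed.

Lemma norm_C0_ge0 r x : 0 <= r -> (0 <= norm_C0 r x)%E.
Proof.
move=> r0; apply: (@le_trans _ _ (enorm (x 0))%:E); first by rewrite lee_fin enorm_ge0.
by apply: ereal_sup_ubound; exists 0 => //=; rewrite in_itv/= lexx oppr_le0 r0.
Qed.

Lemma norm_le_norm_C0 r x M s :
  (norm_C0 r x <= M%:E)%E -> s \in `[- r, 0] -> `|x s| <= M.
Proof. by move=> /norm_C0_leP xM sI; apply: le_trans (norm_le_enorm _) (xM _ sI). Qed.

Lemma norm_C0_le_norm r x M : (forall s, s \in `[- r, 0] -> `|x s| <= M) ->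
  (norm_C0 r x <= (c * M)%:E)%E.
Proof.
move=> xM; apply/norm_C0_leP => s sI; apply: le_trans (enorm_le_norm _) _.
by rewrite ler_wpM2l// xM.
Qed.

Definition holder r a H x : Prop := forall s t, s \in `[- r, 0] -> t \in `[- r, 0] ->
  `|x s - x t| <= H * `|s - t| `^ a.

Lemma holder_seminorm_holder r a x H : 0 < a -> 0 <= H ->
  (holder_seminorm r a x <= H%:E)%E -> holder r a H x.
Proof.
move=> a0 H0 xH s t sI tI; have [->|st] := eqVneq s t.
  by rewrite !subrr !normr0 powR0 ?gt_eqF// mulr0.
have st0 : 0 < `|s - t| `^ a by rewrite powR_gt0// normr_gt0 subr_eq0.
apply: le_trans (norm_le_enorm _) _; rewrite -ler_pdivrMr// -lee_fin.
by apply: le_trans xH; apply: ereal_sup_ubound; exists (s, t).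
Qed.

Lemma holder_holder_seminorm r a x H :
  holder r a H x -> (holder_seminorm r a x <= (c * H)%:E)%E.
Proof.
move=> xH; apply: ge_ereal_sup => _ [[s t] [/= sI tI st] <-].
have st0 : 0 < `|s - t| `^ a by rewrite powR_gt0// normr_gt0 subr_eq0.
rewrite lee_fin ler_pdivrMr// -mulrA; apply: le_trans (enorm_le_norm _) _.
by rewrite ler_wpM2l// xH.
Qed.

Lemma powR_small a e : 0 < a -> 0 < e -> exists2 d : R, 0 < d & d `^ a <= e.
Proof.
move=> a0 e0; exists (e `^ a^-1); first exact: powR_gt0.
by rewrite -powRrM mulVf ?gt_eqF// powRr1// ltW.
Qed.

Lemma holder_C0 r a x H : 0 < a -> 0 <= H -> holder r a H x -> C0 r x.
Proof.
move=> a0 H0 xH; apply/subspace_continuousP => s sI.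
apply/cvgrPdist_le => e e0.
have H1 : 0 < H + 1 by lra.
have [d d0 de] := powR_small a0 (divr_gt0 e0 H1).
rewrite near_withinE; near=> t => tI.
apply: le_trans (xH _ _ _ _) _ => //.
apply: (@le_trans _ _ (H * d `^ a)).
  (* |s - t| <= d holds for t near s *)
  apply: ler_wpM2l => //; apply: ge0_ler_powR; rewrite ?nnegrE ?(ltW a0) ?(ltW d0)//.
move: de; rewrite ler_pdivlMr// => de; apply: le_trans de.
by rewrite mulrC ler_wpM2l ?powR_ge0//; lra.
Unshelve. all: by end_near. Qed.

(** The same condition for the maximum norm, with arbitrary pointwise bounds in
    place of suprema, so that no extended real numbers occur. *)
Definition lipschitz_with r f (L : R -> R) : Prop := forall M D x y, 0 <= M ->
    C0 r x -> C0 r y ->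
    (forall s, s \in `[- r, 0] -> `|x s| <= M) ->
    (forall s, s \in `[- r, 0] -> `|y s| <= M) ->
    (forall s, s \in `[- r, 0] -> `|x s - y s| <= D) ->
    `|f x - f y| <= L M * D.

Lemma lipschitz_norm r f : 0 < r -> lipschitz_on_bounded_sets r f ->
  exists2 L : R -> R, forall M, 0 <= M -> 0 <= L M & lipschitz_with r f L.
Proof.
move=> r0 [L [L0 _ Lf]]; exists (fun M => L (c * M) * c).
  by move=> M M0; rewrite mulr_ge0// L0// mulr_ge0.
move=> M D x y M0 xC yC xM yM xyD; have cM0 : 0 <= c * M by rewrite mulr_ge0.
apply: le_trans (norm_le_enorm _) _; rewrite -lee_fin.
apply: le_trans (Lf (c * M) x y cM0 xC yC (norm_C0_le_norm xM) (norm_C0_le_norm yM)) _.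
rewrite -mulrA EFinM; apply: lee_wpmul2l; first by rewrite lee_fin L0.
exact: norm_C0_le_norm.
Qed.

End state_space.

(** * Solutions: continuity, growth and stability *)

Section solutions.
Context {R : realType} {n : nat}.
Variables (r : R) (r0 : 0 < r) (f : (R -> 'rV[R]_n) -> 'rV[R]_n).
Implicit Types (x y : R -> 'rV[R]_n) (s t : R).

(** Freezing the argument at -r turns continuity on [-r, +oo[ into continuity on
    the line, which composes without side conditions. *)
Lemma solution_continuous x0 x : is_solution f r x0 +oo%E x ->
  continuous (fun s => x (Num.max (- r) s)).
Proof.
move=> [_ xc _ _ _] s; set A := [set t | _] in xc.
have As u : A (Num.max (- r) u) by split; [rewrite le_max lexx|rewrite ltry].
apply: (@cvg_comp _ _ _ (fun u => Num.max (- r) u) x _ (within A (nbhs (Num.max (- r) s)))).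
  move=> P /= wP.
  have mc : Num.max (- r) u @[u --> s] --> Num.max (- r) s.
    apply: (@continuous_max R R (fun=> - r) id s); [exact: cvg_cst|exact: cvg_id].
  apply: (@filterS _ (nbhs s) _ (fun u => A (Num.max (- r) u) -> P (Num.max (- r) u))).
    by move=> u; apply.
  exact: mc _ wP.
by move/subspace_continuousP: xc; apply.
Qed.

Lemma solution_history_C0 x0 x t : is_solution f r x0 +oo%E x -> 0 <= t ->
  C0 r (history x t).
Proof.
move=> xsol t0; have xc := solution_continuous xsol.
apply: (@subspace_eq_continuous _ _ _ (fun s => x (Num.max (- r) (t + s)))).
  move=> s; rewrite inE/= in_itv/= => /andP[rs _]; rewrite /history max_r//.
  by rewrite (le_trans rs)// lerDr.
apply: continuous_subspaceT => s.
apply: (@continuous_comp _ _ _ (fun s => t + s) (fun s => x (Num.max (- r) s))).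
  by apply: cvgD; [exact: cvg_cst|exact: cvg_id].
exact: xc.
Qed.

Lemma solution_continuous_itv x0 x a b : is_solution f r x0 +oo%E x -> - r <= a ->
  {within `[a, b], continuous x}.
Proof.
move=> xsol ra; have xc := solution_continuous xsol.
apply: (@subspace_eq_continuous _ _ _ (fun s => x (Num.max (- r) s))).
  move=> s; rewrite inE/= in_itv/= => /andP[as_ _]; rewrite max_r//.
  exact: le_trans as_.
exact: continuous_subspaceT.
Qed.

Lemma solution_bounded x0 x T : is_solution f r x0 +oo%E x ->
  exists2 M : R, 0 <= M & forall s, - r <= s -> s <= T -> `|x s| <= M.
Proof.
move=> xsol; have xc := solution_continuous_itv (b := T) xsol (lexx (- r)).
have : compact (x @` `[- r, T]).
  by apply: continuous_compact => //; exact: segment_compact.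
move=> /compact_bounded [M [Mr HM]]; exists (Num.max 0 (M + 1)); first by rewrite le_max lexx.
move=> s rs sT; rewrite le_max; apply/orP; right; apply: HM; first by rewrite ltrDl.
by exists s => //=; rewrite in_itv/= rs.
Qed.

(** In the maximum norm it suffices to apply the mean value theorem to
    W - g, where g is a coordinate of [e] or its opposite. *)
Lemma mean_value_inequality (e de : R -> 'rV[R]_n) (W dW : R -> R) a b :
  a <= b -> {within `[a, b], continuous e} -> {within `[a, b], continuous W} ->
  (forall t, a < t -> t < b -> is_derive t 1 e (de t)) ->
  (forall t, a < t -> t < b -> is_derive t 1 W (dW t)) ->
  (forall t, a < t -> t < b -> `|de t| <= dW t) ->
  `|e b - e a| <= W b - W a.
Proof.
move=> ab ec Wc De DW deW.
case: (ltgtP a b) ab => // [ab _|-> _]; last by rewrite !subrr normr0.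
have key (g dg : R -> R) : {within `[a, b], continuous g} ->
    (forall t, a < t -> t < b -> is_derive t 1 g (dg t)) ->
    (forall t, a < t -> t < b -> dg t <= dW t) -> g b - g a <= W b - W a.
  move=> gc Dg gW.
  have [||u] := @MVT R (W - g) (fun t => dW t - dg t) a b ab.
  - move=> t; rewrite in_itv/= => /andP[at_ tb].
    by have := DW t at_ tb; have := Dg t at_ tb; move=> *; exact: is_deriveB.
  - exact: within_continuousB.
  rewrite in_itv/= => /andP[au ub]; rewrite !fctE => E.
  have : 0 <= (dW u - dg u) * (b - a).
    by rewrite mulr_ge0// subr_ge0 ?gW// ltW.
  rewrite -E; lra.
have ei i : {within `[a, b], continuous (fun t => e t ord0 i)}.
  move=> t; apply: (@continuous_comp _ _ _ (e : subspace _ -> _) (fun v : 'rV[R]_n => v ord0 i)).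
    exact: ec.
  exact: coord_continuous.
have Di i t : a < t -> t < b -> is_derive t 1 (fun t => e t ord0 i) (de t ord0 i).
  move=> at_ tb; have [e1 e2] := De t at_ tb.
  apply: DeriveDef; first exact: (derivable_mxP _ _ _).1.
  by rewrite -e2 derive_mx// mxE.
have key0 : 0 <= W b - W a.
  have := key (fun=> 0) (fun=> 0); rewrite subrr; apply.
  - by move=> t; exact: cvg_cst.
  - by move=> t at_ tb; apply: le_trans (deW t at_ tb).
rewrite /Num.Def.normr/= mx_normrE; apply: bigmax_le => // -[j i] _ /=.
rewrite ord1 !mxE ler_norml; apply/andP; split.
  have := key (fun t => - e t ord0 i) (fun t => - de t ord0 i).
  rewrite opprK lerNl opprD opprK; apply.
  - by move=> t; apply: continuousN; exact: ei.
  - by move=> t at_ tb; have := Di i t at_ tb => ?; exact: is_deriveN.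
  - move=> t at_ tb; apply: le_trans (deW t at_ tb); apply: le_trans (entry_le_norm _ i).
    by rewrite -normrN ler_norm.
apply: (key (fun t => e t ord0 i) (fun t => de t ord0 i)) => [|t at_ tb]; first exact: ei.
by apply: le_trans (deW t at_ tb); apply: le_trans (entry_le_norm _ i); exact: ler_norm.
Qed.

End solutions.

Section stability.
Context {R : realType} {n : nat}.
Variables (r : R) (r0 : 0 < r) (f : (R -> 'rV[R]_n) -> 'rV[R]_n) (L : R -> R).
Hypothesis f0 : f (fun=> 0) = 0.
Hypothesis L0 : forall M, 0 <= M -> 0 <= L M.
Hypothesis fL : lipschitz_with r f L.
Implicit Types (x y : R -> 'rV[R]_n) (s t T M : R).

Lemma field_bound M x : 0 <= M -> C0 r x ->
  (forall s, s \in `[- r, 0] -> `|x s| <= M) -> `|f x| <= L M * M.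
Proof.
move=> M0 xC xM; rewrite -[f x]subr0 -f0; apply: fL => //.
- by move=> s; exact: cvg_cst.
- by move=> s _; rewrite normr0.
- by move=> s sI; rewrite subr0; exact: xM.
Qed.

Lemma history_itv t s : s \in `[- r, 0] -> 0 <= t -> - r <= t + s <= t.
Proof. by rewrite in_itv/= => /andP[rs s0] t0; apply/andP; split; lra. Qed.

Lemma solution_speed x0 x M T t : is_solution f r x0 +oo%E x -> 0 <= M ->
  (forall s, - r <= s -> s <= T -> `|x s| <= M) -> 0 <= t -> t <= T ->
  `|f (history x t)| <= L M * M.
Proof.
move=> xsol M0 xM t0 tT; apply: field_bound => //; first exact: solution_history_C0 xsol t0.
by move=> s sI; have /andP[h1 h2] := history_itv sI t0; apply: xM => //; exact: le_trans tT.
Qed.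

Lemma solution_lipschitz x0 x M T u v : is_solution f r x0 +oo%E x -> 0 <= M ->
  (forall s, - r <= s -> s <= T -> `|x s| <= M) -> 0 <= u -> u <= v -> v <= T ->
  `|x v - x u| <= L M * M * (v - u).
Proof.
move=> xsol M0 xM u0 uv vT; rewrite mulrBr.
apply: (mean_value_inequality (e := x) (de := fun t => f (history x t))
  (W := fun t => L M * M * t) (dW := fun=> L M * M)) => //.
- apply: (solution_continuous_itv xsol); apply: le_trans u0.
  by rewrite oppr_le0 ltW.
- apply: continuous_subspaceT => t; apply: cvgMr; exact: cvg_id.
- by move=> t ut tv; case: xsol => _ _ _ _; apply; rewrite ?ltry//; exact: le_lt_trans ut.
- move=> t ut tv; have := @is_deriveZ _ R R id (L M * M) t 1 1.
  by rewrite [_ *: 1]mulr1; apply; exact: is_derive_id.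
- move=> t ut tv; apply: (solution_speed xsol M0 xM); apply/ltW.
    exact: le_lt_trans ut.
  exact: lt_le_trans vT.
Qed.

(** Two solutions whose data are [d]-close stay within [2 d exp(L t)], as long
    as this is at most 1: at a first time where the bound is attained, both
    histories have been in the ball of radius [M + 1], so the difference has
    grown at most as fast as the bound, from a strictly smaller value. *)
Lemma solution_stable x0 y0 x y M T d (w := fun t => 2 * d * expR (L (M + 1) * t)) :
  is_solution f r x0 +oo%E x -> is_solution f r y0 +oo%E y -> 0 <= M -> 0 < d -> 0 <= T ->
  (forall s, - r <= s -> s <= T -> `|x s| <= M) ->
  (forall s, s \in `[- r, 0] -> `|y0 s - x0 s| <= d) -> w T <= 1 ->
  forall t, - r <= t -> t <= T -> `|y t| <= M + 1.
Proof.
move=> xsol ysol M0 d0 T0 xM d_yx wT.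
have r_gt0 := r0.
have M1 : 0 <= M + 1 by lra.
have L10 : 0 <= L (M + 1) by exact: L0.
pose e : R -> 'rV[R]_n := fun t => y t - x t.
have w_le s t : s <= t -> w s <= w t.
  by move=> st; rewrite ler_pM2l ?mulr_gt0// ler_expR ler_wpM2l.
have w0 : w 0 = 2 * d by rewrite /w mulr0 expR0 mulr1.
have e_past s : s \in `[- r, 0] -> `|e s| <= d.
  move=> sI; case: xsol => _ _ xx0 _ _; case: ysol => _ _ yy0 _ _.
  by rewrite /e xx0// yy0// d_yx.
have ec a b : - r <= a -> {within `[a, b], continuous e}.
  move=> ra; apply: within_continuousB; [exact: solution_continuous_itv ysol ra|].
  exact: solution_continuous_itv xsol ra.
have wc : continuous w.
  move=> t; apply: cvgMr; apply: continuous_comp; last exact: continuous_expR.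
  by apply: cvgMr; exact: cvg_id.
(* It suffices to exclude times at which the bound is attained. *)
have suff_e t : - r <= t -> t <= T -> (0 < t -> `|e t| < w t) -> `|y t| <= M + 1.
  move=> rt tT et; have -> : y t = x t + e t by rewrite /e addrC subrK.
  apply: le_trans (ler_normD _ _) _; apply: lerD; first exact: xM.
  have [t0|t0] := ltP 0 t.
    by apply: le_trans (ltW (et t0)) _; apply: le_trans wT; exact: w_le.
  apply: (@le_trans _ _ d); first by apply: e_past; rewrite in_itv/= rt.
  by have := w_le _ _ T0; rewrite w0; lra.
suff bound t : 0 <= t -> t <= T -> `|e t| < w t.
  by move=> t rt tT; apply: suff_e => // t0; apply: bound => //; exact: ltW.
move=> t0 tT; rewrite ltNge; apply/negP => wt.
pose bad := [set s | [/\ 0 <= s, s <= T & w s <= `|e s|]].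
have bad_t : bad t by [].
have bad_lb : lbound bad 0 by move=> s [].
have bad_inf : has_inf bad by split; [exists t|exists 0].
pose t1 := inf bad.
have t10 : 0 <= t1 by apply: lb_le_inf => //; exists t.
have t1T : t1 <= T by apply: le_trans tT; apply: ge_inf => //; exists 0.
have before s : 0 <= s -> s < t1 -> `|e s| < w s.
  move=> s0 st1; rewrite ltNge; apply/negP => ws; have : t1 <= s.
    apply: ge_inf; first by exists 0.
    by split => //; apply: le_trans t1T; exact: ltW.
  by rewrite leNgt st1.
(* The bound is attained at the infimum, by continuity. *)
have wt1 : w t1 <= `|e t1|.
  rewrite leNgt; apply/negP => et1.
  have hc : {within `[- r, T + 1], continuous (fun s => w s - `|e s|)}.
    apply: within_continuousB; first exact: continuous_subspaceT.
    move=> s; apply: continuous_comp; first exact: ec.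
    exact: norm_continuous.
  have := (@subspace_continuousP _ `[- r, T + 1] _ _).1 hc t1.
  have t1I : `[- r, T + 1]%classic t1 by rewrite /= in_itv/=; apply/andP; split; lra.
  move=> /(_ t1I) /cvgrPdist_lt /(_ _ (_ : 0 < w t1 - `|e t1|)).
  rewrite subr_gt0 => /(_ et1); rewrite near_withinE => /nbhs_ballP[/= eps eps0 H].
  have [s [s0 sT ws] st1] := inf_adherent eps0 bad_inf.
  have t1s : t1 <= s by apply: ge_inf; [exists 0|].
  have sb : `|t1 - s| < eps by rewrite -/t1 in st1; rewrite ltr_norml; apply/andP; split; lra.
  have sI : s \in `[- r, T + 1] by rewrite in_itv/=; apply/andP; split; lra.
  by have := H s sb sI; rewrite /from_subspace/= ltr_norml => /andP[_] h; lra.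
have De s : 0 < s -> is_derive s 1 e (f (history y s) - f (history x s)).
  move=> s0; apply: is_deriveB.
    by case: ysol => _ _ _ _; apply => //; rewrite ltry.
  by case: xsol => _ _ _ _; apply => //; rewrite ltry.
(* Up to t1 both histories stay in the ball of radius M + 1 and differ by at
   most w, and the derivative of w is L (M + 1) * w. *)
have : `|e t1 - e 0| <= w t1 - w 0.
  apply: (mean_value_inequality (e := e) (de := fun s => f (history y s) - f (history x s))
    (W := w) (dW := fun s => L (M + 1) * w s)) => //.
  - by apply: ec; lra.
  - exact: continuous_subspaceT.
  - by move=> s s0 _; exact: De.
  - move=> s _ _; have D1 : is_derive s 1 (fun u : R => L (M + 1) * u) (L (M + 1)).
      have := @is_deriveZ _ R R id (L (M + 1)) s 1 1.
      by rewrite [_ *: 1]mulr1; apply; exact: is_derive_id.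
    have D2 := is_derive1_comp (is_derive_expR (L (M + 1) * s)) D1.
    have := @is_deriveZ _ R R _ (2 * d) s 1 _ D2.
    rewrite (_ : _ *: _ = L (M + 1) * w s)//.
    by rewrite /w /GRing.scale/=; ring.
  move=> s s0 st1; apply: fL => //.
  - exact: solution_history_C0 ysol (ltW s0).
  - exact: solution_history_C0 xsol (ltW s0).
  - move=> u uI; have /andP[h1 h2] := history_itv uI (ltW s0).
    have suT : s + u <= T by apply: le_trans t1T; apply: le_trans h2 (ltW st1).
    apply: suff_e => // su0; apply: before; first exact: ltW.
    exact: le_lt_trans st1.
  - move=> u uI; have /andP[h1 h2] := history_itv uI (ltW s0).
    have suT : s + u <= T by apply: le_trans t1T; apply: le_trans h2 (ltW st1).
    by apply: le_trans (xM _ h1 suT) _; lra.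
  move=> u uI; have /andP[h1 h2] := history_itv uI (ltW s0).
  have [su|su] := leP (s + u) 0; last first.
    apply: (@le_trans _ _ (w (s + u))); last exact: w_le.
    by apply/ltW/before; [exact: ltW|exact: le_lt_trans st1].
  apply: (@le_trans _ _ d); first by apply: e_past; rewrite in_itv/= h1.
  by have := w_le _ _ (ltW s0); rewrite w0; lra.
have e0d : `|e 0| <= d by apply: e_past; rewrite in_itv/= lexx oppr_le0 ltW.
have := ler_normD (e t1 - e 0) (e 0); rewrite subrK w0; lra.
Qed.

End stability.

(** * Compactness of Hoelder balls *)

Section compactness.
Context {R : realType} {n : nat}.
Implicit Types (r a rho M H : R) (x y v : R -> 'rV[R]_n).

Lemma compact_norm_ball rho : compact [set v : 'rV[R]_n | `|v| <= rho].
Proof.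
apply: bounded_closed_compact.
  exists rho; split; first exact: num_real.
  by move=> M rM v /= vr; apply: le_trans vr _; exact: ltW.
have := (@continuous_closedP _ _ (fun v : 'rV[R]_n => `|v|)).1 (@norm_continuous _ _).
move=> closed_pre; exact: (closed_pre [set u | u <= rho] (@closed_le _ rho)).
Qed.

(** Sequential compactness of Hoelder balls for uniform convergence on [-r, 0]:
    a cluster point for pointwise convergence exists by Tychonoff's theorem, and
    equicontinuity makes closeness on a finite grid uniform. *)
Lemma holder_ball_cluster r a rho (y : nat -> R -> 'rV[R]_n) :
  0 < r -> 0 < a -> 0 <= rho ->
  (forall k s, s \in `[- r, 0] -> `|y k s| <= rho) ->
  (forall k, holder r a rho (y k)) ->
  exists2 v, holder r a rho v &
    forall (d : R) (K : nat), 0 < d -> exists2 k, (K <= k)%N &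
      forall s, s \in `[- r, 0] -> `|y k s - v s| <= d.
Proof.
move=> r0 a0 rho0 ybnd yhol.
have nr0 : - r <= 0 by rewrite oppr_le0 ltW.
(* Values outside [-r, 0] are replaced by end values, so that all of them are
   bounded and Tychonoff's theorem applies. *)
pose Y k : prod_topology (fun=> 'rV[R]_n) := fun s : R => y k (clamp (- r) 0 s).
have YE k s : s \in `[- r, 0] -> Y k s = y k s.
  by rewrite in_itv/= => /andP[rs s0]; rewrite /Y clamp_id.
have cpt := @tychonoff R (fun=> 'rV[R]_n) (fun=> [set v | `|v| <= rho])
  (fun _ => @compact_norm_ball rho).
have YB : (Y @ \oo) [set g : forall _ : R, 'rV[R]_n | forall s, `|g s| <= rho].
  by exists 0%N => // k _ s; apply: ybnd; rewrite in_itv/=; exact: clamp_itv.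
have [v [vB vcl]] := cpt (Y @ \oo) _ YB.
have FF : Filter (nbhs (v : prod_topology (fun=> 'rV[R]_n))) := nbhs_filter _.
have freq (B : set (prod_topology (fun=> 'rV[R]_n))) (K : nat) :
    nbhs (v : prod_topology (fun=> 'rV[R]_n)) B -> exists2 k, (K <= k)%N & B (Y k).
  move=> vB'; have FK : (Y @ \oo) [set g | exists2 k, (K <= k)%N & g = Y k].
    by exists K => // k /= Kk; exists k.
  by have [g [[k Kk ->] Bk]] := vcl _ _ FK vB'; exists k.
have nbhs_pt s e : 0 < e ->
    nbhs (v : prod_topology (fun=> 'rV[R]_n)) [set g | `|g s - v s| < e].
  move=> e0; apply: (@filterS _ _ FF
      [set g | ball (v s) e (g s)]).
    by move=> g /=; rewrite -ball_normE/= distrC.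
  exact: (@proj_continuous R (fun=> 'rV[R]_n) s v _ (nbhsx_ballx (v s) e e0)).
have vhol : holder r a rho v.
  move=> s t sI tI; apply/ler_addgt0Pr => e e0; have e20 : 0 < e / 2 by lra.
  have nb := @filterI _ _ FF _ _ (nbhs_pt s _ e20) (nbhs_pt t _ e20).
  have [k _ [ks' kt']] := freq _ 0%N nb.
  move: ks' kt'; rewrite /= !YE// => ks kt; have := yhol k s t sI tI.
  have := ler_normD (y k s - y k t) (v s - y k s + (y k t - v t)).
  have := ler_normD (v s - y k s) (y k t - v t).
  rewrite (distrC (v s)).
  have -> : y k s - y k t + (v s - y k s + (y k t - v t)) = v s - v t.
    by rewrite addrACA [y k s + _]addrC subrK addKr.
  by lra.
exists v => // d K d0.
have e0 : 0 < d / (3 * (rho + 1)) by rewrite divr_gt0//; lra.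
have [eta eta0 etad] := powR_small a0 e0.
have rho_eta (u : R) : 0 <= u -> u <= eta -> rho * u `^ a <= d / 3.
  move=> u0 ue; apply: (@le_trans _ _ (rho * eta `^ a)).
    by apply: ler_wpM2l => //; apply: ge0_ler_powR; rewrite ?nnegrE ?(ltW a0) ?(ltW eta0).
  apply: (@le_trans _ _ ((rho + 1) * (d / (3 * (rho + 1))))).
    apply: ler_pM => //; [exact: powR_ge0|lra].
  rewrite (_ : _ * _ = d / 3)//; field.
  by rewrite gt_eqF//; lra.
(* Times s are compared with the nearest grid point on their left. *)
pose N := Num.truncn (r / eta); pose pt (j : nat) := - r + j%:R * eta.
have d30 : 0 < d / 3 by lra.
have nb := @filter_forall _ 'I_N.+1 _ _ FF (fun j => nbhs_pt (pt j) _ d30).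
have [k Kk kU] := freq _ K nb.
exists k => // s sI; move: (sI); rewrite in_itv/= => /andP[rs s0].
have q0 : 0 <= (s + r) / eta by rewrite divr_ge0// ?(ltW eta0)//; lra.
have jN : (Num.truncn ((s + r) / eta) < N.+1)%N.
  rewrite ltnS; apply: le_truncn; apply: ler_wpM2r; first by rewrite invr_ge0 ltW.
  by lra.
pose j := Ordinal jN.
have /andP[j1 j2] := truncn_itv q0.
have ptd : 0 <= s - pt j <= eta.
  move: j1 j2; rewrite /pt/=; set q := Num.truncn _ => j1 j2.
  have h1 : q%:R * eta <= s + r by rewrite -ler_pdivlMr.
  have h2 : s + r < (q%:R + 1) * eta by rewrite -ltr_pdivrMr// natr1.
  by apply/andP; split; lra.
have ptI : pt j \in `[- r, 0].
  rewrite in_itv/= lerDl mulr_ge0 ?(ltW eta0)//=.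
  by case/andP: ptd; lra.
have := kU j; rewrite /= YE// => kj.
have near_pt (g : R -> 'rV[R]_n) : holder r a rho g -> `|g s - g (pt j)| <= d / 3.
  move=> ghol; apply: le_trans (ghol _ _ sI ptI) _.
  by case/andP: ptd => p0 pe; apply: rho_eta => //; rewrite ger0_norm.
have := near_pt _ (yhol k); have := near_pt _ vhol; rewrite (distrC (v s)).
have := ler_normD (y k s - y k (pt j)) ((y k (pt j) - v (pt j)) + (v (pt j) - v s)).
have := ler_normD (y k (pt j) - v (pt j)) (v (pt j) - v s).
by rewrite !subrKA; lra.
Qed.

End compactness.

(** * Uniform bounds on the flow *)

Section flow.
Context {R : realType} {n : nat}.
Variables (r : R) (r0 : 0 < r) (f : (R -> 'rV[R]_n) -> 'rV[R]_n).
Hypothesis f0 : f (fun=> 0) = 0.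
Hypothesis f_lip : lipschitz_on_bounded_sets r f.
Variables (a : R) (a0 : 0 < a).
Hypothesis f_complete : forall x0 : R -> 'rV[R]_n, C0a r a x0 ->
  exists x : R -> 'rV[R]_n, is_solution f r x0 +oo%E x.
Implicit Types (x y : R -> 'rV[R]_n) (s t T M : R).

Lemma holder_C0a H x : 0 <= H -> holder r a H x -> C0a r a x.
Proof.
move=> H0 xH; split; first exact: holder_C0 xH.
by apply: le_lt_trans (holder_holder_seminorm xH) _; rewrite ltry.
Qed.

(** By contradiction: data in the ball whose solutions exceed k = 0, 1, 2, ...
    accumulate at a point of the ball, whose solution is bounded by some M;
    stability then bounds the solutions from nearby data by M + 1. *)
Lemma flow_bounded rho T : 0 <= rho -> 0 <= T -> exists2 M : R, 0 <= M &
  forall x0 x, (forall s, s \in `[- r, 0] -> `|x0 s| <= rho) ->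
    holder r a rho x0 -> is_solution f r x0 +oo%E x ->
    forall t, - r <= t -> t <= T -> `|x t| <= M.
Proof.
move=> rho0 T0; have [L L0 fL] := lipschitz_norm r0 f_lip.
apply: contrapT => unbounded.
have /choice[z zP] (k : nat) : exists z : (R -> 'rV[R]_n) * ((R -> 'rV[R]_n) * R),
    [/\ forall s, s \in `[- r, 0] -> `|z.1 s| <= rho, holder r a rho z.1,
      is_solution f r z.1 +oo%E z.2.1 & [/\ - r <= z.2.2, z.2.2 <= T &
      k%:R < `|z.2.1 z.2.2|]].
  apply: contrapT => noz; apply: unbounded; exists k%:R => // x0 x h1 h2 h3 t rt tT.
  by rewrite leNgt; apply/negP => kt; apply: noz; exists (x0, (x, t)).
have [v vhol vcl] := holder_ball_cluster r0 a0 rho0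
  (fun k => let: And4 h _ _ _ := zP k in h) (fun k => let: And4 _ h _ _ := zP k in h).
have [xv xvsol] := f_complete (holder_C0a rho0 vhol).
have [M M0 xvM] := solution_bounded T xvsol.
(* This makes the bound 2 d exp(L t) of the deviation equal to 1 at time T. *)
pose d := (2 * expR (L (M + 1) * T))^-1.
have E0 : 0 < expR (L (M + 1) * T) by exact: expR_gt0.
have d0 : 0 < d by rewrite invr_gt0 mulr_gt0.
have [k kM kd] := vcl d (Num.bound (M + 1)) d0.
have [_ _ ysol [rt tT]] := zP k; apply/negP; rewrite -leNgt.
have wT : 2 * d * expR (L (M + 1) * T) <= 1.
  by rewrite mulrAC mulfV// gt_eqF// mulr_gt0.
apply: le_trans (solution_stable r0 L0 fL xvsol ysol M0 d0 T0 xvM kd wT rt tT) _.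
apply: (@le_trans _ _ (Num.bound (M + 1))%:R); last by rewrite ler_nat.
by apply/ltW/archi_boundP; lra.
Qed.

Lemma max_timey x0 : C0a r a x0 -> max_time f r x0 = +oo%E.
Proof.
move=> /f_complete xsol; apply/eqP; rewrite eq_le leey/=.
by apply: ereal_sup_ubound.
Qed.

Lemma max_solutionP x0 : C0a r a x0 ->
  is_solution f r x0 +oo%E (max_solution f r x0).
Proof.
move=> x0C; have [x xsol] := f_complete x0C.
rewrite /max_solution -[X in is_solution _ _ _ X](max_timey x0C).
by apply: (@xgetPex _ _ [set x | is_solution f r x0 (max_time f r x0) x]); exists x; rewrite /= max_timey.
Qed.

(** Bounded states have bounded velocities f(x_t); this is all that the estimates
    in both function spaces need to know of the trajectories. *)
Lemma flow_bounded_lipschitz rho T : 0 <= rho -> 0 <= T -> exists M K : R,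
  [/\ 0 <= M, 0 <= K & forall x0, (forall s, s \in `[- r, 0] -> `|x0 s| <= rho) ->
    holder r a rho x0 -> let x := max_solution f r x0 in
    [/\ max_time f r x0 = +oo%E, {in `[- r, 0], x =1 x0},
      forall t, - r <= t -> t <= T -> `|x t| <= M,
      forall u v, 0 <= u -> u <= v -> v <= T -> `|x v - x u| <= K * (v - u) &
      forall t, 0 < t -> t < T -> `|derive1 x t| <= K]].
Proof.
move=> rho0 T0; have [L L0 fL] := lipschitz_norm r0 f_lip.
have [M M0 HM] := flow_bounded rho0 T0.
exists M, (L M * M); split => //; first by rewrite mulr_ge0// L0.
move=> x0 x0rho x0hol x; have x0C := holder_C0a rho0 x0hol.
have xsol := max_solutionP x0C; have xM := HM _ _ x0rho x0hol xsol.
split; [exact: max_timey|by case: xsol|exact: xM| |].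
- by move=> u v u0 uv vT; exact: (solution_lipschitz r0 f0 fL xsol M0 xM u0 uv vT).
- move=> t t0 tT; rewrite derive1E.
  have -> : 'D_1 x t = f (history x t).
    by case: xsol => _ _ _ _ /(_ t t0 (ltry _)) D; rewrite derive_val.
  exact: (solution_speed f0 fL xsol M0 xM (ltW t0) (ltW tT)).
Qed.

End flow.

Section reachability.
Context {R : realType} {n : nat}.
Implicit Types (x : R -> 'rV[R]_n) (r a t : R).

Lemma le_powR_itv r a d : 0 <= r -> 0 < a -> a <= 1 -> 0 <= d -> d <= r ->
  d <= (r + 1) * d `^ a.
Proof.
move=> r0 a0 a1 d0 dr; have [d1|d1] := leP d 1.
  have da : d <= d `^ a.
    have [->|dn0] := eqVneq d 0; first exact: powR_ge0.
    by apply: ger1_powR => //; rewrite lt_neqAle eq_sym dn0 d0.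
  apply: le_trans da _; rewrite ler_peMl ?powR_ge0//; lra.
have da : 1 <= d `^ a.
  have := @ge0_ler_powR R a (ltW a0) 1 d; rewrite powR1 /=; apply; rewrite ?nnegrE//.
  exact: ltW.
apply: (@le_trans _ _ (r + 1)); first lra.
by rewrite ler_peMr//; lra.
Qed.

(** Time differences are at most [r], so that a Lipschitz estimate is a Hoelder
    estimate up to the factor of [le_powR_itv]. *)
Lemma holder_history r a rho x0 x t K : 0 <= r -> 0 < a -> a <= 1 -> 0 <= rho ->
  0 <= K -> 0 <= t -> {in `[- r, 0], x =1 x0} -> holder r a rho x0 ->
  (forall u v, 0 <= u -> u <= v -> v <= t -> `|x v - x u| <= K * (v - u)) ->
  holder r a (rho + K * (r + 1)) (history x t).
Proof.
move=> r0 a0 a1 rho0 K0 t0 xx0 x0hol xK.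
have ordered u v : - r <= u -> u <= v -> v <= 0 ->
    `|history x t v - history x t u| <= (rho + K * (r + 1)) * `|v - u| `^ a.
  move=> ru uv v0; have vu0 : 0 <= v - u by lra.
  apply: le_trans (history_increment r0 t0 K0 xx0 xK ru uv v0) _.
  rewrite mulrDl (ger0_norm vu0); apply: lerD.
    apply: le_trans (x0hol _ _ _ _) _; rewrite ?in_itv/=; last first.
    - apply: ler_wpM2l => //; apply: ge0_ler_powR; rewrite ?nnegrE ?(ltW a0)//.
      by rewrite ger0_norm ?pastB_le// subr_ge0 past_le.
    - exact: past_itv.
    - by apply: past_itv => //; exact: le_trans uv.
  by rewrite -mulrA; apply: ler_wpM2l => //; apply: le_powR_itv => //; lra.
move=> u v; rewrite !in_itv/= => /andP[ru u0] /andP[rv v0].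
have [uv|vu] := leP u v; first by rewrite distrC [`|u - v|]distrC; exact: ordered.
by apply: ordered => //; exact: ltW.
Qed.

End reachability.

(** * Robust forward completeness *)

Section bounded_reachability.
Context {R : realType} {n : nat}.
Variables (r : R) (r0 : 0 < r) (f : (R -> 'rV[R]_n) -> 'rV[R]_n).
Hypothesis f0 : f (fun=> 0) = 0.
Hypothesis f_lip : lipschitz_on_bounded_sets r f.

Lemma RFC_of_bound (X : set (R -> 'rV[R]_n)) (normX : (R -> 'rV[R]_n) -> \bar R) :
  (forall rho T : R, 0 < rho -> 0 < T -> exists B : R, forall t x0,
    t \in `[0, T] -> X x0 -> (normX x0 <= rho%:E)%E ->
    [/\ (t%:E < max_time f r x0)%E, X (phi f r t x0) &
        (normX (phi f r t x0) <= B%:E)%E]) ->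
  RFC f r X normX.
Proof.
move=> H rho T rho0 T0; have [B HB] := H rho T rho0 T0; split.
  by move=> t x0 tT x0X x0rho; have [] := HB t x0 tT x0X x0rho.
apply: (@le_lt_trans _ _ B%:E); last by rewrite ltry.
apply: ge_ereal_sup => _ [t tT [x0 [x0X x0rho]] <-].
by have [] := HB t x0 tT x0X x0rho.
Qed.

Lemma phi_norm_C0 M T t x0 : t \in `[0, T] ->
  (forall t, - r <= t -> t <= T -> `|max_solution f r x0 t| <= M) ->
  (norm_C0 r (phi f r t x0) <= (n.+1%:R * M)%:E)%E.
Proof.
rewrite in_itv/= => /andP[t0 tT] xM; apply: norm_C0_le_norm => s sI.
have /andP[h1 h2] := history_itv sI t0.
by apply: xM => //; exact: le_trans tT.
Qed.

Variable p : \bar R.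
Hypothesis p1 : (1 < p)%E.
Let a := holder_exponent p.
Hypothesis f_complete : forall x0 : R -> 'rV[R]_n, C0a r a x0 ->
  exists x : R -> 'rV[R]_n, is_solution f r x0 +oo%E x.

(** Morrey's embedding puts the data in a Hoelder ball, on which the flow is
    uniformly bounded. *)
Lemma RFC_W1p : RFC f r (W1p r p) (norm_W1p r p).
Proof.
have /andP[a0 a1] := holder_exponent_itv p1.
apply: RFC_of_bound => rho T rho0 T0.
have [M [K [M0 K0 flow]]] :=
  flow_bounded_lipschitz r0 f0 f_lip a0 f_complete (ltW rho0) (ltW T0).
pose C : R := n.+1%:R * K.
have C0 : 0 <= C by rewrite mulr_ge0.
have Clty := @Lnorm_cst_itv_lty R C r p p1.
set N := Lnorm _ _ _ in Clty.
have Nfin : N \is a fin_num by rewrite ge0_fin_numE// Lnorm_ge0.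
exists (n.+1%:R * M + (rho + fine N)) => t x0 tT [x0ac _] x0rho.
have Lrho : (norm_Lp_deriv r p x0 <= rho%:E)%E.
  apply: le_trans x0rho; rewrite /norm_W1p leeDr//.
  exact: norm_C0_ge0 (ltW r0).
have Crho : (norm_C0 r x0 <= rho%:E)%E.
  by apply: le_trans x0rho; rewrite /norm_W1p leeDl// Lnorm_ge0.
have x0hol : holder r a rho x0.
  move=> s u; rewrite !in_itv/= => /andP[rs s0] /andP[ru u0].
  have [su|us] := leP s u.
    rewrite distrC [`|s - u|]distrC ger0_norm ?subr_ge0//.
    exact: (W1p_holder r0 p1 x0ac Lrho).
  rewrite [`|s - u|]ger0_norm ?subr_ge0 ?(ltW us)//.
  by apply: (W1p_holder r0 p1 x0ac Lrho) => //; exact: ltW.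
have [tmax xx0 xM xK dxK] := flow x0 (fun s => norm_le_norm_C0 Crho) x0hol.
move: (tT); rewrite in_itv/= => /andP[t0 tT'].
have Lphi : (norm_Lp_deriv r p (phi f r t x0) <= rho%:E + N)%E.
  apply: le_trans (Lp_deriv_history r0 p1 t0 C0 x0ac xx0 _) _.
    move=> s s0 st; apply: le_trans (enorm_le_norm _) _; rewrite ler_wpM2l//.
    by apply: dxK => //; exact: lt_le_trans tT'.
  by rewrite leeD2r.
split.
- by rewrite tmax ltry.
- split.
    apply: abs_continuous_history (ltW r0) t0 K0 x0ac xx0 _.
    by move=> u v u0 uv vt; apply: xK => //; exact: le_trans tT'.
  by apply: le_lt_trans Lphi _; rewrite lte_add_pinfty ?ltry.
- rewrite EFinD EFinD fineK//; apply: leeD => //; exact: phi_norm_C0 tT xM.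
Qed.

Lemma RFC_C0a : RFC f r (C0a r a) (norm_C0a r a).
Proof.
have /andP[a0 a1] := holder_exponent_itv p1.
apply: RFC_of_bound => rho T rho0 T0.
have [M [K [M0 K0 flow]]] :=
  flow_bounded_lipschitz r0 f0 f_lip a0 f_complete (ltW rho0) (ltW T0).
pose H := rho + K * (r + 1).
have H0 : 0 <= H by rewrite addr_ge0 ?mulr_ge0 ?addr_ge0 ?(ltW r0) ?(ltW rho0).
exists (Num.max (n.+1%:R * M) (n.+1%:R * H)) => t x0 tT _.
rewrite /norm_C0a ge_max => /andP[Crho hrho].
have x0hol := holder_seminorm_holder a0 (ltW rho0) hrho.
have [tmax xx0 xM xK _] := flow x0 (fun s => norm_le_norm_C0 Crho) x0hol.
move: (tT); rewrite in_itv/= => /andP[t0 tT'].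
have phihol : holder r a H (phi f r t x0).
  apply: holder_history (ltW r0) a0 a1 (ltW rho0) K0 t0 xx0 x0hol _.
  by move=> u v u0 uv vt; apply: xK => //; exact: le_trans tT'.
split; [by rewrite tmax ltry|exact: holder_C0a phihol|].
rewrite EFin_max ge_max !le_max; apply/andP; split; apply/orP; [left|right].
  exact: phi_norm_C0 tT xM.
exact: holder_holder_seminorm.
Qed.

End bounded_reachability.

Theorem theorem2 (R : realType) (n : nat) (r : R) (hr : 0 < r)
    (f : (R -> 'rV[R]_n) -> 'rV[R]_n)
    (f0 : f (fun=> 0) = 0)
    (f_lip : lipschitz_on_bounded_sets r f)
    (p : \bar R) (hp : (1 < p)%E)
    (f_complete : forall x0 : R -> 'rV[R]_n, C0a r (holder_exponent p) x0 ->
       exists x : R -> 'rV[R]_n, is_solution f r x0 +oo%E x) :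
  RFC f r (W1p r p) (norm_W1p r p) /\
  RFC f r (C0a r (holder_exponent p)) (norm_C0a r (holder_exponent p)).
Proof. by split; [exact: RFC_W1p|exact: RFC_C0a]. Qed.
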